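(* Let $a,b\in\mathbb{C}$. (i) If $a\neq 1$ or $b\neq 0$, then any finite nontrivial irreducible conformal $\mathcal{W}(a,b)$-module is free of rank one over $\mathbb{C}[\partial]$ and is isomorphic to $M_{\alpha,\beta}$ for some $\alpha,\beta\in\mathbb{C}$ with $\alpha\neq 0$. (ii) Any finite nontrivial irreducible conformal $\mathcal{W}(1,0)$-module is free of rank one over $\mathbb{C}[\partial]$ and is isomorphic to $M_{\alpha,\beta,\gamma}$ for some $\alpha,\beta,\gamma\in\mathbb{C}$ with $\alpha\neq 0$ or $\gamma\neq 0$.
   Context: All vector spaces are over $\mathbb{C}$. A Lie conformal algebra $\mathcal{R}$ is a $\mathbb{C}[\partial]$-module with a $\mathbb{C}$-linear map $\mathcal{R}\otimes\mathcal{R}\to\mathbb{C}[\lambda]\otimes\mathcal{R}$, $x\otimes y\mapsto[x_\lambda y]$, such that $[\partial x_\lambda y]=-\lambda[x_\lambda y]$, $[x_\lambda\partial y]=(\partial+\lambda)[x_\lambda y]$, $[x_\lambda y]=-[y_{-\lambda-\partial}x]$ and $[x_\lambda[y_\mu z]]=[[x_\lambda y]_{\lambda+\mu}z]+[y_\mu[x_\lambda z]]$. A conformal module $V$ over $\mathcal{R}$ is a $\mathbb{C}[\partial]$-module with a $\mathbb{C}$-linear map $\mathcal{R}\otimes V\to\mathbb{C}[\lambda]\otimes V$, $x\otimes v\mapsto x_\lambda v$, such that $(\partial x)_\lambda v=-\lambda x_\lambda v$, $x_\lambda(\partial v)=(\partial+\lambda)x_\lambda v$ and $x_\lambda(y_\mu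 v)-y_\mu(x_\lambda v)=[x_\lambda y]_{\lambda+\mu}v$. It is finite if finitely generated over $\mathbb{C}[\partial]$; its rank is its rank as a $\mathbb{C}[\partial]$-module; it is trivial if $x_\lambda v=0$ for all $x\in\mathcal{R}$, $v\in V$; it is irreducible if it is nonzero and has no conformal submodules other than $0$ and itself. For $a,b\in\mathbb{C}$, $\mathcal{W}(a,b)$ is the Lie conformal algebra which is a free $\mathbb{C}[\partial]$-module with basis $L,W$ and $$[L_\lambda L]=(\partial+2\lambda)L,\quad [L_\lambda W]=(\partial+a\lambda+b)W,\quad [W_\lambda W]=0.$$ If $a\neq1$ or $b\neq 0$, for $\alpha,\beta\in\mathbb{C}$ the $\mathcal{W}(a,b)$-module $M_{\alpha,\beta}=\mathbb{C}[\partial]v$ is free of rank one over $\mathbb{C}[\partial]$ with $L_\lambda v=(\partial+\alpha\lambda+\beta)v$, $W_\lambda v=0$. For $\alpha,\beta,\gamma\in\mathbb{C}$ the $\mathcal{W}(1,0)$-module $M_{\alpha,\beta,\gamma}=\mathbb{C}[\partial]v$ is free of rank one over $\mathbb{C}[\partial]$ with $L_\lambda v=(\partial+\alpha\lambda+\beta)v$, $W_\lambda v=\gamma v$. *)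

(* Defs.v *)
From HB Require Import structures.
From mathcomp Require Import all_boot all_order all_algebra.
From mathcomp Require Import finmap.
From mathcomp Require Import ring.

Set Implicit Arguments.
Unset Strict Implicit.
Unset Printing Implicit Defensive.

Import Order.TTheory GRing.Theory Num.Theory.
Local Open Scope ring_scope.

(* A K[∂]-module is an lmodType over {poly K}: ∂ acts as 'X, a scalar c of K
   as c%:P. *)

(* K[λ] ⊗ V: the element \sum_n λ^n ⊗ f n is the finitely supported f. *)
Notation lpoly V := {fsfun nat -> V with (0 : V)}.

(* K[∂][λ]: the outer variable is λ, the coefficients are polynomials in ∂. *)
Local Notation lam := ('X : {poly {poly _}}).
Local Notation del := ('X%:P : {poly {poly _}}).

Section Lambda.
Variable K : fieldType.

(* The coefficient of λ^n in P f, where K[∂][λ] acts on K[λ] ⊗ V. *)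
Definition lscale (V : lmodType {poly K}) (P : {poly {poly K}}) (f : lpoly V)
    (n : nat) : V :=
  \sum_(i < n.+1) P`_i *: f (n - i)%N.

Record conf_bilinear (R V : lmodType {poly K}) (A : R -> V -> lpoly V) :
    Prop := ConfBilinear {
  cb_addl : forall x y v n, A (x + y) v n = A x v n + A y v n;
  cb_addr : forall x v w n, A x (v + w) n = A x v n + A x w n;
  cb_scalel : forall (c : K) x v n, A (c%:P *: x) v n = c%:P *: A x v n;
  cb_scaler : forall (c : K) x v n, A x (c%:P *: v) n = c%:P *: A x v n;
  cb_dell : forall x v n, A ('X *: x) v n = lscale (- lam) (A x v) n;
  cb_delr : forall x v n, A x ('X *: v) n = lscale (del + lam) (A x v) n
}.

(* The coefficient of λ^i μ^j in λ^k (λ + μ)^m; here the inner variable 'X%:P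
   stands for λ and the outer variable 'X for μ. *)
Definition coef_lam_mu (k m i j : nat) : K :=
  (('X%:P ^+ k * ('X%:P + 'X) ^+ m : {poly {poly K}})`_j)`_i.

(* The coefficient of λ^i μ^j in r_{λ+μ} v, for r in K[λ] ⊗ R:
   r_{λ+μ} v = \sum_k \sum_m λ^k (λ + μ)^m (A (r k) v m). *)
Definition act_lam_mu (R V : lmodType {poly K}) (A : R -> V -> lpoly V)
    (r : lpoly R) (v : V) (i j : nat) : V :=
  \sum_(k <- finsupp r) \sum_(m <- finsupp (A (r k) v))
    (coef_lam_mu k m i j)%:P *: A (r k) v m.

(* The coefficient of λ^n in f(-λ-∂), i.e. in \sum_k (-λ-∂)^k (f k). *)
Definition subst_skew (V : lmodType {poly K}) (f : lpoly V) (n : nat) : V :=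
  \sum_(k <- finsupp f) ((- lam - del) ^+ k)`_n *: f k.

(* In lca_jacobi and cm_comm the two sides are compared coefficientwise, at
   λ^i μ^j. *)
Record lieConfAlg := LieConfAlg {
  lca_sort :> lmodType {poly K};
  lbr : lca_sort -> lca_sort -> lpoly lca_sort;
  lca_bilinear : conf_bilinear lbr;
  lca_skew : forall x y n, lbr x y n = - subst_skew (lbr y x) n;
  lca_jacobi : forall x y z i j,
    lbr x (lbr y z j) i = act_lam_mu lbr (lbr x y) z i j + lbr y (lbr x z i) j
}.

Record confModule (R : lieConfAlg) := ConfModule {
  cm_sort :> lmodType {poly K};
  cact : R -> cm_sort -> lpoly cm_sort;
  cm_bilinear : conf_bilinear cact;
  cm_comm : forall x y v i j,
    cact x (cact y v j) i - cact y (cact x v i) j =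
      act_lam_mu cact (lbr x y) v i j
}.

Definition finite_module (V : lmodType {poly K}) : Prop :=
  exists (n : nat) (g : 'I_n -> V),
    forall v, exists c : 'I_n -> {poly K}, v = \sum_i c i *: g i.

Definition free_rank_one (V : lmodType {poly K}) : Prop :=
  exists e : V, bijective (fun p : {poly K} => p *: e).

Section Modules.
Variables (R : lieConfAlg) (V : confModule R).

Definition trivial_module : Prop :=
  forall (x : R) (v : V) n, cact x v n = 0.

Record conf_submodule (U : V -> Prop) : Prop := ConfSubmodule {
  csub0 : U 0;
  csubD : forall u w, U u -> U w -> U (u + w);
  csubZ : forall (p : {poly K}) u, U u -> U (p *: u);
  csub_act : forall (x : R) u n, U u -> U (cact x u n)
}.

Definition irreducible_module : Prop :=
  (exists v : V, v <> 0) /\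
  forall U : V -> Prop, conf_submodule U ->
    (forall u, U u -> u = 0) \/ (forall u, U u).

Definition module_iso (M : confModule R) : Prop :=
  exists f : {linear V -> M},
    bijective f /\ forall (x : R) v n, f (cact x v n) = cact x (f v) n.
End Modules.

End Lambda.

Section Evaluation.
Variable K : numFieldType.
Implicit Types V : lmodType {poly K}.

Definition mklpoly V (F : nat -> V) (N : nat) : lpoly V :=
  [fsfun n in seq_fset tt (iota 0 N) => F n].

Lemma mklpolyE V (F : nat -> V) N n :
  (forall i, (N <= i)%N -> F i = 0) -> mklpoly F N n = F n.
Proof.
move=> FN; rewrite /mklpoly fsfun_fun seq_fsetE mem_iota /= add0n.
by case: ltnP => // /FN ->.
Qed.

Definition lsize V (f : lpoly V) : nat := \max_(n <- finsupp f) n.+1.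

Lemma lsizeP V (f : lpoly V) n : (lsize f <= n)%N -> f n = 0.
Proof.
move=> fn; apply: fsfun_dflt; apply/negP => nf.
have := @leq_bigmax_seq _ (finsupp f : seq nat) xpredT succn n nf isT.
by rewrite -/(lsize f) => /leq_trans /(_ fn); rewrite ltnn.
Qed.

Lemma big_finsupp V (W : nmodType) (f : lpoly V) (F : nat -> W) N :
  (forall n, f n = 0 -> F n = 0) -> (lsize f <= N)%N ->
  \sum_(n <- finsupp f) F n = \sum_(n < N) F n.
Proof.
move=> F0 fN; rewrite -(big_mkord xpredT F).
rewrite [RHS](bigID (fun n => n \in finsupp f) xpredT) /=.
rewrite [X in _ + X]big1 ?addr0; last first.
  by move=> n nf; apply: F0; apply: fsfun_dflt.
rewrite -[RHS]big_filter; apply: perm_big; apply: uniq_perm.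
- exact: fset_uniq.
- by rewrite filter_uniq // iota_uniq.
move=> n; rewrite mem_filter mem_index_iota /=.
have [nf|//] := boolP (n \in finsupp f).
by rewrite ltnNge; apply/esym/negP => /(leq_trans fN) /lsizeP/eqP; apply/negP;
  rewrite -mem_finsupp.
Qed.

(* The value of f at λ = l. *)
Definition lev V (l : K) (f : lpoly V) : V :=
  \sum_(n <- finsupp f) (l ^+ n)%:P *: f n.

Lemma levE V l (f : lpoly V) N : (lsize f <= N)%N ->
  lev l f = \sum_(n < N) (l ^+ n)%:P *: f n.
Proof. by apply: big_finsupp => n ->; rewrite scaler0. Qed.

Lemma weights N (n : 'I_N) : exists w : 'I_N -> K, forall i : 'I_N,
  \sum_t w t * (t%:R) ^+ i = (i == n)%:R.
Proof.
pose a : 'rV[K]_N := \row_t t%:R.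
have uV : Vandermonde N a \in unitmx.
  rewrite unitmxE det_Vandermonde unitfE; apply/prodf_neq0 => i _.
  apply/prodf_neq0 => j ij; rewrite !mxE subr_eq0 eqr_nat.
  by rewrite neq_ltn ij orbT.
exists (fun t => invmx (Vandermonde N a) t n) => i.
have := congr1 (fun M : 'M_N => M i n) (mulmxV uV).
rewrite !mxE => <-; apply: eq_bigr => t _.
by rewrite !mxE mulrC.
Qed.

Lemma lev_inj V N (F : nat -> V) :
  (forall l : K, \sum_(i < N) (l ^+ i)%:P *: F i = 0) ->
  forall i, (i < N)%N -> F i = 0.
Proof.
move=> F0 n nN; have [w wE] := weights (Ordinal nN).
have : \sum_(t < N) (w t)%:P *: (\sum_(i < N) ((t%:R) ^+ i)%:P *: F i) = 0.
  by rewrite big1 // => t _; rewrite F0 scaler0.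
under eq_bigr do rewrite scaler_sumr.
rewrite exchange_big /= => <-.
transitivity (\sum_(i < N) ((i == Ordinal nN)%:R)%:P *: F i).
  rewrite (bigD1 (Ordinal nN)) //= eqxx scale1r big1 ?addr0 // => i /negPf ->.
  by rewrite scale0r.
apply: eq_bigr => i _; rewrite -wE rmorph_sum /= scaler_suml.
by apply: eq_bigr => t _; rewrite scalerA -polyCM.
Qed.

Lemma lev2_inj V N (F : nat -> nat -> V) :
  (forall l m : K,
     \sum_(j < N) (m ^+ j)%:P *: (\sum_(i < N) (l ^+ i)%:P *: F i j) = 0) ->
  forall i j, (i < N)%N -> (j < N)%N -> F i j = 0.
Proof.
move=> F0 i j iN jN; move: i iN; apply: lev_inj => l.
move: j jN; apply: (lev_inj (F := fun j =>
  \sum_(i < N) (l ^+ i)%:P *: F i j)) => m.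
exact: F0.
Qed.

Lemma coef_lam_muE (k n N : nat) (l m : K) : (k + n < N)%N ->
  \sum_(j < N) \sum_(i < N) m ^+ j * l ^+ i * coef_lam_mu K k n i j =
    l ^+ k * (l + m) ^+ n.
Proof.
move=> knN; rewrite /coef_lam_mu.
pose P : {poly {poly K}} := 'X%:P ^+ k * ('X%:P + 'X) ^+ n; rewrite -/P.
have -> : l ^+ k * (l + m) ^+ n = (P.[m%:P]).[l].
  by rewrite /P !hornerE.
have PE : P = \sum_(t < n.+1) ('X^(k + (n - t)) *+ 'C(n, t)) *: 'X^t.
  rewrite /P exprDn mulr_sumr; apply: eq_bigr => t _.
  rewrite -mul_polyC -!polyC_exp mulrnAr mulrA -polyCM -exprD.
  by rewrite polyCMn mulrnAl.
have sP : (size P <= N)%N.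
  rewrite PE; apply: leq_trans (size_sum _ _ _) _; apply/bigmax_leqP => t _.
  apply: leq_trans (size_scale_leq _ _) _; rewrite size_polyXn.
  by apply: leq_trans knN; rewrite ltnS (leq_trans (leq_ord t)) ?leq_addl.
have sPj j : (size (P`_j)%R <= N)%N.
  rewrite PE coef_sum; apply: leq_trans (size_sum _ _ _) _.
  apply/bigmax_leqP => t _; rewrite coefZ coefXn.
  case: eqP => _; last by rewrite mulr0 size_poly0.
  rewrite mulr1 -scaler_nat; apply: leq_trans (size_scale_leq _ _) _;
  rewrite size_polyXn.
  by apply: leq_trans knN; rewrite ltnS leq_add2l leq_subr.
rewrite (horner_coef_wide _ sP) horner_sum; apply: eq_bigr => j _.
rewrite -polyC_exp hornerM hornerC (horner_coef_wide _ (sPj j)) mulr_suml.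
by apply: eq_bigr => i _; ring.
Qed.

(* The λ^i μ^j-coefficients of the Jacobi identity follow from its values at all
   l, m in K, as K is infinite; this is used below to check the examples. *)
Section Jacobi.
Variables (R V : lmodType {poly K}) (A : R -> V -> lpoly V).
Hypothesis cbA : conf_bilinear A.

Lemma A0l v n : A 0 v n = 0.
Proof. by apply: (addrI (A 0 v n)); rewrite -(cb_addl cbA) !addr0. Qed.

Lemma A0r x n : A x 0 n = 0.
Proof. by apply: (addrI (A x 0 n)); rewrite -(cb_addr cbA) !addr0. Qed.

Lemma A_suml N (c : nat -> K) (r : nat -> R) v n :
  A (\sum_(k < N) (c k)%:P *: r k) v n = \sum_(k < N) (c k)%:P *: A (r k) v n.
Proof.
rewrite (big_morph (fun x => A x v n) (fun x y => cb_addl cbA x y v n)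
  (A0l v n)).
by apply: eq_bigr => k _; rewrite (cb_scalel cbA).
Qed.

Lemma A_sumr N (c : nat -> K) x (r : nat -> V) n :
  A x (\sum_(k < N) (c k)%:P *: r k) n = \sum_(k < N) (c k)%:P *: A x (r k) n.
Proof.
rewrite (big_morph (fun v => A x v n) (fun v w => cb_addr cbA x v w n)
  (A0r x n)).
by apply: eq_bigr => k _; rewrite (cb_scaler cbA).
Qed.

Lemma lev_nest x (f : lpoly V) : exists B, forall N, (B <= N)%N ->
  forall l m, lev l (A x (lev m f)) =
    \sum_(j < N) (m ^+ j)%:P *: (\sum_(i < N) (l ^+ i)%:P *: A x (f j) i).
Proof.
exists (maxn (lsize f) (\max_(j < lsize f) lsize (A x (f j)))) => N BN l m.
have fN : (lsize f <= N)%N by apply: leq_trans BN; apply: leq_maxl.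
have AN j : (lsize (A x (f j)) <= N)%N.
  have [fj|jf] := leqP (lsize f) j.
    rewrite lsizeP // /lsize; apply/bigmax_leqP_seq => n.
    by rewrite mem_finsupp A0r eqxx.
  apply: leq_trans BN; apply: leq_trans (leq_maxr _ _).
  exact: (leq_bigmax (Ordinal jf) (F := fun j : 'I__ => lsize (A x (f j)))).
have sumN k : (N <= k)%N -> A x (lev m f) k = 0.
  move=> Nk; rewrite (levE m fN) (A_sumr _ (fun k => m ^+ k)) big1 // => j _.
  by rewrite lsizeP ?scaler0 // (leq_trans (AN j)).
have lN : (lsize (A x (lev m f)) <= N)%N.
  rewrite /lsize; apply/bigmax_leqP_seq => n nf _.
  rewrite ltnNge; apply/negP => /sumN/eqP.
  by apply/negP; rewrite -mem_finsupp.
rewrite (levE l lN).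
under eq_bigr do rewrite (levE m fN) (A_sumr _ (fun k => m ^+ k)) scaler_sumr.
rewrite exchange_big /=; apply: eq_bigr => j _; rewrite scaler_sumr.
by apply: eq_bigr => i _; rewrite !scalerA mulrC.
Qed.

Lemma lev_lam_mu (r : lpoly R) v : exists B, forall N, (B <= N)%N ->
  forall l m, lev (l + m) (A (lev l r) v) =
    \sum_(j < N) (m ^+ j)%:P *:
      (\sum_(i < N) (l ^+ i)%:P *: act_lam_mu A r v i j).
Proof.
pose B := maxn (lsize r) (\max_(k < lsize r) lsize (A (r k) v)).
exists (B + B)%N => N BN l m.
have rB : (lsize r <= B)%N by apply: leq_maxl.
have AB k : (lsize (A (r k) v) <= B)%N.
  have [rk|kr] := leqP (lsize r) k.
    rewrite lsizeP // /lsize; apply/bigmax_leqP_seq => n.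
    by rewrite mem_finsupp A0l eqxx.
  apply: leq_trans (leq_maxr _ _).
  exact: (leq_bigmax (Ordinal kr) (F := fun k : 'I__ => lsize (A (r k) v))).
have sumB t : (B <= t)%N -> A (lev l r) v t = 0.
  move=> Bt; rewrite (levE l rB) (A_suml _ (fun k => l ^+ k)) big1 // => j _.
  by rewrite lsizeP ?scaler0 // (leq_trans (AB j)).
have lB : (lsize (A (lev l r) v) <= B)%N.
  rewrite /lsize; apply/bigmax_leqP_seq => n nf _.
  rewrite ltnNge; apply/negP => /sumB/eqP.
  by apply/negP; rewrite -mem_finsupp.
rewrite (levE _ lB).
under eq_bigr do rewrite (levE l rB) (A_suml _ (fun k => l ^+ k)) scaler_sumr.
have actE i j : act_lam_mu A r v i j = \sum_(k < B) \sum_(t < B)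
    (coef_lam_mu K k t i j)%:P *: A (r k) v t.
  rewrite /act_lam_mu (big_finsupp (N := B)) // => [|k ->]; last first.
    by rewrite big1 // => t _; rewrite A0l scaler0.
  apply: eq_bigr => k _; rewrite (big_finsupp (N := B)) // => t ->.
  by rewrite scaler0.
transitivity (\sum_(k < B) \sum_(t < B) \sum_(j < N) \sum_(i < N)
    (m ^+ j * l ^+ i * coef_lam_mu K k t i j)%:P *: A (r k) v t).
  rewrite exchange_big /=; apply: eq_bigr => k _; apply: eq_bigr => t _.
  under [RHS]eq_bigr do rewrite -scaler_suml -rmorph_sum.
  rewrite -scaler_suml -rmorph_sum /= coef_lam_muE.
    by rewrite scalerA -polyCM mulrC.
  by apply: leq_trans BN; rewrite -addSn leq_add // ltnW.
under eq_bigr do rewrite exchange_big /=.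
rewrite exchange_big /=; apply: eq_bigr => j _.
rewrite scaler_sumr.
under eq_bigr do rewrite exchange_big /=.
rewrite exchange_big /=; apply: eq_bigr => i _.
rewrite actE !scaler_sumr; apply: eq_bigr => k _.
rewrite !scaler_sumr; apply: eq_bigr => t _.
by rewrite !scalerA -!polyCM.
Qed.

Lemma jacobi_eval x y (r : lpoly R) v :
  (forall l m, lev l (A x (lev m (A y v))) =
     lev (l + m) (A (lev l r) v) + lev m (A y (lev l (A x v)))) ->
  forall i j, A x (A y v j) i = act_lam_mu A r v i j + A y (A x v i) j.
Proof.
move=> E i j.
have [B1 E1] := lev_nest x (A y v); have [B2 E2] := lev_nest y (A x v).
have [B3 E3] := lev_lam_mu r v.
pose N := maxn (maxn i.+1 j.+1) (maxn B1 (maxn B2 B3)).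
have [iN jN B1N B2N B3N] : [/\ (i < N)%N, (j < N)%N, (B1 <= N)%N, (B2 <= N)%N
    & (B3 <= N)%N].
  by rewrite /N !leq_max !leqnn !orbT.
apply/eqP; rewrite -subr_eq0; apply/eqP.
apply: (@lev2_inj V N (fun i j => A x (A y v j) i -
  (act_lam_mu A r v i j + A y (A x v i) j))) => // l m.
have E2' : lev m (A y (lev l (A x v))) = \sum_(j < N) (m ^+ j)%:P *:
    \sum_(i < N) (l ^+ i)%:P *: A y (A x v i) j.
  rewrite (E2 N) //; under eq_bigr do rewrite scaler_sumr.
  rewrite exchange_big /=; apply: eq_bigr => j' _; rewrite scaler_sumr.
  by apply: eq_bigr => i' _; rewrite !scalerA mulrC.
have := E l m; rewrite (E1 N) // E2' (E3 N) // => /eqP.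
rewrite -subr_eq0 => /eqP E0; apply: etrans E0.
rewrite -big_split -sumrB; apply: eq_bigr => j' _ /=.
rewrite -scalerDr -scalerBr; congr (_ *: _).
rewrite -big_split -sumrB; apply: eq_bigr => i' _ /=.
by rewrite -scalerDr -scalerBr.
Qed.

End Jacobi.
End Evaluation.

Section Examples.
Variable K : numFieldType.
Implicit Types (f h : {poly K}) (p q : {poly {poly K}}).

Local Notation "c %:S" := (c%:P%:P : {poly {poly K}})
  (at level 1, format "c %:S").

(* f(-λ) and h(∂+λ): by sesquilinearity,
   [f(∂)x_λ h(∂)y] = f(-λ) h(∂+λ) [x_λ y]. *)
Definition at_neg f : {poly {poly K}} := f^:P \Po (- lam).
Definition at_shift h : {poly {poly K}} := h^:P \Po (del + lam).

Definition lpoly1 q : lpoly {poly K}^o :=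
  mklpoly (fun n => q`_n : {poly K}^o) (size q).

Definition lpoly2 p q : lpoly ({poly K}^o * {poly K}^o)%type :=
  mklpoly (fun n => (p`_n, q`_n) : ({poly K}^o * {poly K}^o)%type)
    (maxn (size p) (size q)).

Lemma lpoly1E q n : lpoly1 q n = q`_n.
Proof. by rewrite mklpolyE // => i; apply: nth_default. Qed.

Lemma lpoly2E p q n : lpoly2 p q n = (p`_n, q`_n).
Proof.
by rewrite mklpolyE // => i; rewrite geq_max => /andP[? ?]; rewrite !nth_default.
Qed.

Lemma sum_pair (I : Type) (s : seq I) (F G : I -> {poly K}^o) :
  \sum_(i <- s) ((F i, G i) : ({poly K}^o * {poly K}^o)%type) =
    (\sum_(i <- s) F i, \sum_(i <- s) G i).
Proof.
by elim: s => [|i s IH]; rewrite ?big_nil // !big_cons IH.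
Qed.

Lemma lsize_le (V : lmodType {poly K}) (g : lpoly V) N :
  (forall n, (N <= n)%N -> g n = 0) -> (lsize g <= N)%N.
Proof.
move=> gN; apply/bigmax_leqP_seq => n nf _.
rewrite ltnNge; apply/negP => /gN/eqP.
by apply/negP; rewrite -mem_finsupp.
Qed.

Lemma lsize1 q : (lsize (lpoly1 q) <= size q)%N.
Proof. by apply: lsize_le => n; rewrite lpoly1E => /(nth_default _). Qed.

Lemma lsize2 p q : (lsize (lpoly2 p q) <= maxn (size p) (size q))%N.
Proof.
apply: lsize_le => n; rewrite lpoly2E geq_max => /andP[? ?].
by rewrite !nth_default.
Qed.

Lemma lev1 l q : lev l (lpoly1 q) = q.[l%:P].
Proof.
rewrite (levE _ (lsize1 q)) horner_coef; apply: eq_bigr => i _.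
by rewrite lpoly1E polyC_exp mulrC.
Qed.

Lemma lev2 l p q : lev l (lpoly2 p q) = (p.[l%:P], q.[l%:P]).
Proof.
rewrite (levE _ (lsize2 p q)).
rewrite (horner_coef_wide _ (leq_maxl (size p) (size q))).
rewrite (horner_coef_wide _ (leq_maxr (size p) (size q))).
rewrite -sum_pair; apply: eq_bigr => i _.
by rewrite lpoly2E polyC_exp [p`_i * _]mulrC [q`_i * _]mulrC.
Qed.

Lemma lscale1 p q n : lscale p (lpoly1 q) n = (p * q)`_n.
Proof.
by rewrite /lscale coefM; apply: eq_bigr => i _; rewrite lpoly1E.
Qed.

Lemma lscale2 p q q' n :
  lscale p (lpoly2 q q') n = ((p * q)`_n, (p * q')`_n).
Proof.
rewrite /lscale !coefM -sum_pair; apply: eq_bigr => i _.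
by rewrite lpoly2E.
Qed.

Lemma subst_skew2 p q n : subst_skew (lpoly2 p q) n =
  ((p \Po (- lam - del))`_n, (q \Po (- lam - del))`_n).
Proof.
rewrite /subst_skew (big_finsupp _ (lsize2 p q)) => [|k ->]; last first.
  by rewrite scaler0.
have E (r : {poly {poly K}}) : (size r <= maxn (size p) (size q))%N -> (r \Po (- lam - del))`_n =
    \sum_(i < maxn (size p) (size q)) ((- lam - del) ^+ i)`_n * r`_i.
  move=> rN; rewrite /comp_poly (horner_coef_wide _ (n := maxn (size p) (size q)))
    ?size_map_polyC // coef_sum; apply: eq_bigr => i _.
  by rewrite coef_map coefCM mulrC.
rewrite (E p) ?leq_maxl // (E q) ?leq_maxr // -sum_pair; apply: eq_bigr => i _.
by rewrite lpoly2E.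
Qed.

Lemma coef_eq p q n : p = q -> p`_n = q`_n.
Proof. by move->. Qed.

Lemma at_negD f h : at_neg (f + h) = at_neg f + at_neg h.
Proof. by rewrite /at_neg rmorphD comp_polyD. Qed.

Lemma at_negM f h : at_neg (f * h) = at_neg f * at_neg h.
Proof. by rewrite /at_neg rmorphM comp_polyM. Qed.

Lemma at_negC (c : K) : at_neg c%:P = c%:S.
Proof. by rewrite /at_neg map_polyC /= comp_polyC. Qed.

Lemma at_negX : at_neg 'X = - lam.
Proof. by rewrite /at_neg map_polyX comp_polyX. Qed.

Lemma at_shiftD f h : at_shift (f + h) = at_shift f + at_shift h.
Proof. by rewrite /at_shift rmorphD comp_polyD. Qed.

Lemma at_shiftM f h : at_shift (f * h) = at_shift f * at_shift h.
Proof. by rewrite /at_shift rmorphM comp_polyM. Qed.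

Lemma at_shiftC (c : K) : at_shift c%:P = c%:S.
Proof. by rewrite /at_shift map_polyC /= comp_polyC. Qed.

Lemma at_shiftX : at_shift 'X = del + lam.
Proof. by rewrite /at_shift map_polyX comp_polyX. Qed.

Lemma at_neg0 : at_neg 0 = 0. Proof. exact: (at_negC 0). Qed.
Lemma at_neg1 : at_neg 1 = 1. Proof. exact: (at_negC 1). Qed.
Lemma at_shift0 : at_shift 0 = 0. Proof. exact: (at_shiftC 0). Qed.
Lemma at_shift1 : at_shift 1 = 1. Proof. exact: (at_shiftC 1). Qed.

Lemma at_neg_skew f : at_neg f \Po (- lam - del) = at_shift f.
Proof.
rewrite /at_neg /at_shift -comp_polyA; congr (_ \Po _).
by rewrite rmorphN /= comp_polyX opprB opprK addrC.
Qed.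

Lemma at_shift_skew f : at_shift f \Po (- lam - del) = at_neg f.
Proof.
rewrite /at_neg /at_shift -comp_polyA; congr (_ \Po _).
by rewrite comp_polyD comp_polyC comp_polyX addrC subrK.
Qed.

Lemma at_neg_eval f (l : K) : (at_neg f).[l%:P] = (f.[- l])%:P.
Proof. by rewrite /at_neg horner_comp !hornerE -polyCN horner_map. Qed.

Lemma at_shift_eval f (l : K) : (at_shift f).[l%:P] = f \Po ('X + l%:P).
Proof. by rewrite /at_shift horner_comp !hornerE. Qed.

(* [L_λ L] = (∂+2λ)L, [L_λ W] = (∂+aλ+b)W and
   [W_λ L] = -[L_{-λ-∂} W] = ((a-1)∂+aλ-b)W, extended by sesquilinearity:
   the L- and W-components of [(f1 L + f2 W)_λ (h1 L + h2 W)]. *)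
Definition bracketL f1 h1 : {poly {poly K}} :=
  at_neg f1 * at_shift h1 * (del + 2%:R * lam).

Definition bracketW (a b : K) f1 f2 h1 h2 : {poly {poly K}} :=
  at_neg f1 * at_shift h2 * (del + a%:S * lam + b%:S)
  + at_neg f2 * at_shift h1 * ((a%:S - 1) * del + a%:S * lam - b%:S).

Definition Wab_carrier : lmodType {poly K} := ({poly K}^o * {poly K}^o)%type.

Definition Wab_bracket (a b : K) (x y : Wab_carrier) : lpoly Wab_carrier :=
  lpoly2 (bracketL x.1 y.1) (bracketW a b x.1 x.2 y.1 y.2).

Section Identities.
Variables (a b : K) (f1 f2 f1' f2' h1 h2 h1' h2' k1 k2 : {poly K}).

Lemma bracketL_addl :
  bracketL (f1 + f1') h1 = bracketL f1 h1 + bracketL f1' h1.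
Proof. by rewrite /bracketL at_negD; ring. Qed.

Lemma bracketL_addr :
  bracketL f1 (h1 + h1') = bracketL f1 h1 + bracketL f1 h1'.
Proof. by rewrite /bracketL at_shiftD; ring. Qed.

Lemma bracketL_mull : bracketL (f1 * f1') h1 = at_neg f1 * bracketL f1' h1.
Proof. by rewrite /bracketL at_negM; ring. Qed.

Lemma bracketL_mulr : bracketL f1 (h1 * h1') = at_shift h1 * bracketL f1 h1'.
Proof. by rewrite /bracketL at_shiftM; ring. Qed.

Lemma bracketW_addl : bracketW a b (f1 + f1') (f2 + f2') h1 h2 =
  bracketW a b f1 f2 h1 h2 + bracketW a b f1' f2' h1 h2.
Proof. by rewrite /bracketW !at_negD; ring. Qed.

Lemma bracketW_addr : bracketW a b f1 f2 (h1 + h1') (h2 + h2') =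
  bracketW a b f1 f2 h1 h2 + bracketW a b f1 f2 h1' h2'.
Proof. by rewrite /bracketW !at_shiftD; ring. Qed.

Lemma bracketW_mull (p : {poly K}) : bracketW a b (p * f1) (p * f2) h1 h2 =
  at_neg p * bracketW a b f1 f2 h1 h2.
Proof. by rewrite /bracketW !at_negM; ring. Qed.

Lemma bracketW_mulr (p : {poly K}) : bracketW a b f1 f2 (p * h1) (p * h2) =
  at_shift p * bracketW a b f1 f2 h1 h2.
Proof. by rewrite /bracketW !at_shiftM; ring. Qed.

Lemma comp_poly2 (S : comNzRingType) (p : {poly S}) :
  (2%:R : {poly S}) \Po p = 2%:R.
Proof. by rewrite -polyC_natr comp_polyC. Qed.

Lemma comp_poly1 (S : comNzRingType) (p : {poly S}) : 1 \Po p = 1.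
Proof. by rewrite -polyC1 comp_polyC. Qed.

Lemma bracketL_skew : bracketL f1 h1 = - (bracketL h1 f1 \Po (- lam - del)).
Proof.
rewrite /bracketL !comp_polyM at_neg_skew at_shift_skew comp_polyD comp_polyM.
by rewrite comp_polyC comp_polyX comp_poly2; ring.
Qed.

Lemma bracketW_skew :
  bracketW a b f1 f2 h1 h2 = - (bracketW a b h1 h2 f1 f2 \Po (- lam - del)).
Proof.
rewrite /bracketW comp_polyD !comp_polyM !at_neg_skew !at_shift_skew.
rewrite comp_polyB !comp_polyD !comp_polyM comp_polyB.
by rewrite -polyC1 !comp_polyC !comp_polyX; ring.
Qed.

Lemma comp_shift2 (l m : K) :
  (h1 \Po ('X + m%:P)) \Po ('X + l%:P) = h1 \Po ('X + (l + m)%:P).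
Proof.
rewrite -comp_polyA comp_polyD comp_polyX comp_polyC; congr (_ \Po _).
by rewrite polyCD; ring.
Qed.

Lemma bracketL_eval (l : K) : (bracketL f1 h1).[l%:P] =
  (f1.[- l])%:P * (h1 \Po ('X + l%:P)) * ('X + 2%:R * l%:P).
Proof.
by rewrite /bracketL !hornerM at_neg_eval at_shift_eval !hornerE; ring.
Qed.

Lemma bracketW_eval (l : K) : (bracketW a b f1 f2 h1 h2).[l%:P] =
  (f1.[- l])%:P * (h2 \Po ('X + l%:P)) * ('X + a%:P * l%:P + b%:P)
  + (f2.[- l])%:P * (h1 \Po ('X + l%:P))
    * ((a%:P - 1) * 'X + a%:P * l%:P - b%:P).
Proof.
rewrite /bracketW hornerD !hornerM !at_neg_eval !at_shift_eval.
by rewrite !hornerE; ring.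
Qed.

Lemma eval_shift (l m : K) :
  (h1 \Po ('X + l%:P)).[- (l + m)] = h1.[- m].
Proof. by rewrite horner_comp !hornerE; congr (_.[_]); ring. Qed.

End Identities.


Lemma bracketL_jacobi f h k (l m : K) :
  (bracketL f (bracketL h k).[m%:P]).[l%:P] =
  (bracketL (bracketL f h).[l%:P] k).[(l + m)%:P] +
  (bracketL h (bracketL f k).[l%:P]).[m%:P].
Proof.
have E := bracketL_eval; move: E; move: bracketL => B E.
rewrite !E !comp_polyM !hornerM eval_shift !comp_shift2 (addrC m l).
rewrite !comp_polyD !comp_polyM !comp_polyC !comp_polyX !comp_poly2.
rewrite !hornerE ?(polyCD, polyCM, polyCN) ?polyC1 /=.
ring.
Qed.

Lemma bracketW_jacobi a b f1 f2 h1 h2 k1 k2 (l m : K) :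
  (bracketW a b f1 f2 (bracketL h1 k1).[m%:P]
    (bracketW a b h1 h2 k1 k2).[m%:P]).[l%:P] =
  (bracketW a b (bracketL f1 h1).[l%:P] (bracketW a b f1 f2 h1 h2).[l%:P]
    k1 k2).[(l + m)%:P] +
  (bracketW a b h1 h2 (bracketL f1 k1).[l%:P]
    (bracketW a b f1 f2 k1 k2).[l%:P]).[m%:P].
Proof.
have EL := bracketL_eval; have EW := bracketW_eval a b.
move: EL EW; move: bracketL (bracketW a b) => BL BW EL EW.
rewrite !EW !EL !hornerD !hornerM !eval_shift. rewrite !(comp_polyB, comp_polyD, comp_polyM) !comp_shift2 (addrC m l).
rewrite !comp_polyC !comp_polyX ?comp_poly2 ?comp_poly1.
rewrite !hornerE ?(polyCD, polyCM, polyCN) ?polyC1 /=.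
ring.
Qed.

Lemma Wab_bracketE a b x y n : Wab_bracket a b x y n =
  ((bracketL x.1 y.1)`_n, (bracketW a b x.1 x.2 y.1 y.2)`_n).
Proof. exact: lpoly2E. Qed.

Lemma Wab_lscale a b x y P n : lscale P (Wab_bracket a b x y) n =
  ((P * bracketL x.1 y.1)`_n, (P * bracketW a b x.1 x.2 y.1 y.2)`_n).
Proof. exact: lscale2. Qed.

Lemma Wab_bilinear a b : conf_bilinear (@Wab_bracket a b).
Proof.
have E := Wab_bracketE a b; have Es := Wab_lscale a b.
move: (Wab_bracket a b) E Es => B E Es.
split=> [[x1 x2] [y1 y2] [v1 v2] n|[x1 x2] [v1 v2] [w1 w2] n
  |c [x1 x2] [v1 v2] n|c [x1 x2] [v1 v2] n|[x1 x2] [v1 v2] n|[x1 x2] [v1 v2] n].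
- by rewrite !E bracketL_addl bracketW_addl 2!coefD.
- by rewrite !E bracketL_addr bracketW_addr 2!coefD.
- by rewrite !E bracketL_mull bracketW_mull at_negC 2!coefCM.
- by rewrite !E bracketL_mulr bracketW_mulr at_shiftC 2!coefCM.
- by rewrite E Es bracketL_mull bracketW_mull at_negX.
- by rewrite E Es bracketL_mulr bracketW_mulr at_shiftX.
Qed.

Lemma Wab_skew a b x y n :
  Wab_bracket a b x y n = - subst_skew (Wab_bracket a b y x) n.
Proof.
case: x y => [x1 x2] [y1 y2].
rewrite Wab_bracketE subst_skew2 /= bracketL_skew bracketW_skew !coefN.
by [].
Qed.

Lemma Wab_lev a b (l : K) x y : lev l (Wab_bracket a b x y) =
  ((bracketL x.1 y.1).[l%:P], (bracketW a b x.1 x.2 y.1 y.2).[l%:P]).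
Proof. exact: lev2. Qed.

Lemma Wab_jacobi a b x y z i j :
  Wab_bracket a b x (Wab_bracket a b y z j) i =
    act_lam_mu (Wab_bracket a b) (Wab_bracket a b x y) z i j +
    Wab_bracket a b y (Wab_bracket a b x z i) j.
Proof.
have E := Wab_lev a b; have cb := @Wab_bilinear a b.
move: (Wab_bracket a b) E cb i j => B E cb.
apply: (jacobi_eval cb) => l m; rewrite !E.
apply: injective_projections; first exact: bracketL_jacobi.
exact: bracketW_jacobi.
Qed.

(* W(a,b). *)
Definition Wab (a b : K) : lieConfAlg K :=
  LieConfAlg (@Wab_bilinear a b) (@Wab_skew a b) (@Wab_jacobi a b).

Definition Wab_L (a b : K) : Wab a b := (1, 0) : Wab_carrier.
Definition Wab_W (a b : K) : Wab a b := (0, 1) : Wab_carrier.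

Lemma Wab_LL a b n : lbr (Wab_L a b) (Wab_L a b) n =
  ((del + 2%:R * lam : {poly {poly K}})`_n) *: Wab_L a b.
Proof.
rewrite [LHS]Wab_bracketE /bracketL /bracketW /= at_neg0 at_neg1 at_shift0.
rewrite at_shift1 !(mulr0, mul0r, mul1r) addr0 coef0.
by apply: injective_projections; rewrite /= /GRing.scale /= ?mulr1 ?mulr0.
Qed.

Lemma Wab_LW a b n : lbr (Wab_L a b) (Wab_W a b) n =
  ((del + a%:S * lam + b%:S : {poly {poly K}})`_n) *: Wab_W a b.
Proof.
rewrite [LHS]Wab_bracketE /bracketL /bracketW /= at_neg0 at_neg1 at_shift0.
rewrite at_shift1 !(mulr0, mul0r, mul1r) addr0 coef0.
by apply: injective_projections; rewrite /= /GRing.scale /= ?mulr1 ?mulr0.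
Qed.

Lemma Wab_WW a b n : lbr (Wab_W a b) (Wab_W a b) n = 0.
Proof.
rewrite [LHS]Wab_bracketE /bracketL /bracketW /= at_neg0 at_neg1 at_shift0.
by rewrite at_shift1 !(mulr0, mul0r, mul1r) addr0 coef0.
Qed.

Lemma Wab_basis a b (x : Wab a b) :
  x = x.1 *: Wab_L a b + x.2 *: Wab_W a b.
Proof.
case: x => x1 x2; apply: injective_projections;
by rewrite /= /GRing.scale /= mulr1 mulr0 ?addr0 ?add0r.
Qed.

(* (f1 L + f2 W)_λ (h v) for L_λ v = (∂+αλ+β)v and W_λ v = γ v. *)
Definition rank1 (alpha beta gamma : K) f1 f2 h : {poly {poly K}} :=
  at_neg f1 * at_shift h * (del + alpha%:S * lam + beta%:S)
  + at_neg f2 * at_shift h * gamma%:S.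

Definition rank1_act (alpha beta gamma : K) (x : Wab_carrier)
    (v : {poly K}^o) : lpoly {poly K}^o :=
  lpoly1 (rank1 alpha beta gamma x.1 x.2 v).

Section Rank1Identities.
Variables (al be ga : K).
Implicit Types k : {poly K}.

Lemma rank1_addl f1 f1' f2 f2' k : rank1 al be ga (f1 + f1') (f2 + f2') k =
  rank1 al be ga f1 f2 k + rank1 al be ga f1' f2' k.
Proof. by rewrite /rank1 2!at_negD; ring. Qed.

Lemma rank1_addr f1 f2 k k' : rank1 al be ga f1 f2 (k + k') =
  rank1 al be ga f1 f2 k + rank1 al be ga f1 f2 k'.
Proof. by rewrite /rank1 at_shiftD; ring. Qed.

Lemma rank1_mull f f1 f2 k : rank1 al be ga (f * f1) (f * f2) k =
  at_neg f * rank1 al be ga f1 f2 k.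
Proof. by rewrite /rank1 2!at_negM; ring. Qed.

Lemma rank1_mulr f f1 f2 k : rank1 al be ga f1 f2 (f * k) =
  at_shift f * rank1 al be ga f1 f2 k.
Proof. by rewrite /rank1 at_shiftM; ring. Qed.

Lemma rank1_eval f1 f2 k (l : K) : (rank1 al be ga f1 f2 k).[l%:P] =
  (f1.[- l])%:P * (k \Po ('X + l%:P)) * ('X + al%:P * l%:P + be%:P)
  + (f2.[- l])%:P * (k \Po ('X + l%:P)) * ga%:P.
Proof.
rewrite /rank1 hornerD !hornerM !at_neg_eval !at_shift_eval.
by rewrite !hornerE; ring.
Qed.

Lemma rank1_comm (a b : K) f1 f2 h1 h2 k (l m : K) :
  ga * (a - 1) = 0 -> ga * b = 0 ->
  (rank1 al be ga f1 f2 (rank1 al be ga h1 h2 k).[m%:P]).[l%:P] =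
  (rank1 al be ga (bracketL f1 h1).[l%:P] (bracketW a b f1 f2 h1 h2).[l%:P]
    k).[(l + m)%:P] +
  (rank1 al be ga h1 h2 (rank1 al be ga f1 f2 k).[l%:P]).[m%:P].
Proof.
move=> ga1 gb.
have Ega : ga%:P * a%:P = ga%:P :> {poly K}.
  by apply/eqP; rewrite -polyCM -subr_eq0 -polyCB -{2}[ga]mulr1 -mulrBr ga1.
have Egb : ga%:P * b%:P = 0 :> {poly K} by rewrite -polyCM gb.
have EL := bracketL_eval; have EW := bracketW_eval a b; have ER := rank1_eval.
move: EL EW ER; move: bracketL (bracketW a b) (rank1 al be ga) => BL BW B.
move=> EL EW ER; rewrite !ER !EL !EW !hornerD !hornerM !eval_shift.
rewrite !(comp_polyB, comp_polyD, comp_polyM) !comp_shift2 (addrC m l).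
rewrite !comp_polyC !comp_polyX.
rewrite !hornerE ?(polyCD, polyCM, polyCN) ?polyC1 /=.
ring: Ega Egb.
Qed.
End Rank1Identities.

Lemma rank1_actE al be ga x v n :
  rank1_act al be ga x v n = (rank1 al be ga x.1 x.2 v)`_n.
Proof. exact: lpoly1E. Qed.

Lemma rank1_lscale al be ga x v P n : lscale P (rank1_act al be ga x v) n =
  (P * rank1 al be ga x.1 x.2 v)`_n.
Proof. exact: lscale1. Qed.

Lemma rank1_lev al be ga (l : K) x v : lev l (rank1_act al be ga x v) =
  (rank1 al be ga x.1 x.2 v).[l%:P].
Proof. exact: lev1. Qed.

Lemma rank1_bilinear al be ga : conf_bilinear (@rank1_act al be ga).
Proof.
have E := rank1_actE al be ga; have Es := rank1_lscale al be ga.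
move: (rank1_act al be ga) E Es => B E Es.
split=> [[x1 x2] [y1 y2] v n|[x1 x2] v w n
  |c [x1 x2] v n|c [x1 x2] v n|[x1 x2] v n|[x1 x2] v n].
- by rewrite !E rank1_addl coefD.
- by rewrite !E rank1_addr coefD.
- by rewrite !E rank1_mull at_negC coefCM.
- by rewrite !E rank1_mulr at_shiftC coefCM.
- by rewrite E Es rank1_mull at_negX.
- by rewrite E Es rank1_mulr at_shiftX.
Qed.

Lemma rank1_cm_comm (a b al be ga : K) :
  ga * (a - 1) = 0 -> ga * b = 0 ->
  forall (x y : Wab a b) v i j,
    rank1_act al be ga x (rank1_act al be ga y v j) i -
      rank1_act al be ga y (rank1_act al be ga x v i) j =
    @act_lam_mu K (Wab a b) _ (rank1_act al be ga) (lbr x y) v i j.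
Proof.
move=> ga1 gb x y v i j; apply/eqP; rewrite subr_eq; apply/eqP.
have E := rank1_lev al be ga; have cb := @rank1_bilinear al be ga.
move: (rank1_act al be ga) E cb i j => B E cb.
apply: (jacobi_eval cb) => l m; rewrite !E [lev l (lbr x y)]Wab_lev.
exact: rank1_comm.
Qed.

Fact rank1_cond0 (a b : K) : 0 * (a - 1) = 0 :> K /\ 0 * b = 0 :> K.
Proof. by rewrite !mul0r. Qed.

Lemma rank1_cond10 (gamma : K) :
  gamma * (1 - 1) = 0 :> K /\ gamma * 0 = 0 :> K.
Proof. by rewrite subrr !mulr0. Qed.

(* M_{α,β}, which is a module for all a and b. *)
Definition M_ab (a b alpha beta : K) : confModule (Wab a b) :=
  @ConfModule K (Wab a b) {poly K}^o (rank1_act alpha beta 0)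
    (@rank1_bilinear alpha beta 0)
    (@rank1_cm_comm a b alpha beta 0
       (rank1_cond0 a b).1 (rank1_cond0 a b).2).

(* M_{α,β,γ}. *)
Definition M_10 (alpha beta gamma : K) : confModule (Wab 1 0) :=
  @ConfModule K (Wab 1 0) {poly K}^o (rank1_act alpha beta gamma)
    (@rank1_bilinear alpha beta gamma)
    (@rank1_cm_comm 1 0 alpha beta gamma
       (rank1_cond10 gamma).1 (rank1_cond10 gamma).2).

Lemma M_ab_L a b al be n :
  cact (Wab_L a b) (1 : M_ab a b al be) n =
    ((del + al%:S * lam + be%:S : {poly {poly K}})`_n) *: (1 : M_ab a b al be).
Proof.
rewrite [LHS]rank1_actE /rank1 /= at_neg0 at_neg1 at_shift1.
by rewrite !(mulr0, mul0r, mul1r, mulr1) addr0 /GRing.scale /= mulr1.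
Qed.

Lemma M_ab_W a b al be n :
  cact (Wab_W a b) (1 : M_ab a b al be) n = 0.
Proof.
rewrite [LHS]rank1_actE /rank1 /= at_neg0 at_neg1 at_shift1.
by rewrite !(mulr0, mul0r, mul1r, mulr1) add0r coef0.
Qed.

Lemma M_10_L al be ga n :
  cact (Wab_L 1 0) (1 : M_10 al be ga) n =
    ((del + al%:S * lam + be%:S : {poly {poly K}})`_n) *: (1 : M_10 al be ga).
Proof.
rewrite [LHS]rank1_actE /rank1 /= at_neg0 at_neg1 at_shift1.
by rewrite !(mulr0, mul0r, mul1r, mulr1) addr0 /GRing.scale /= mulr1.
Qed.

Lemma M_10_W al be ga n :
  cact (Wab_W 1 0) (1 : M_10 al be ga) n =
    (ga%:S`_n) *: (1 : M_10 al be ga).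
Proof.
rewrite [LHS]rank1_actE /rank1 /= at_neg0 at_neg1 at_shift1.
by rewrite !(mulr0, mul0r, mul1r, mulr1) add0r /GRing.scale /= mulr1.
Qed.
End Examples.

(* Main.v *)
Require Import Defs.
From HB Require Import structures.
From mathcomp Require Import all_boot all_order all_algebra.
From mathcomp Require Import reals complex finmap.
From mathcomp Require boolp.
From mathcomp Require Import ring.

(* Write L_λ = \sum_n λ^n L_n and W_λ = \sum_n λ^n W_n on the module V, and
   D = L_0 - ∂; then D commutes with every L_n and [D, W_n] = b W_n.  A finite
   module with zero kernel has finite-dimensional spaces U(N,M) of vectors killed by
   L_n for n >= N and W_n for n >= M, and for N > M these are stable under D,
   L_m (m >= 1) and W_m (m >= 0).  If M is minimal with U(N,M) <> 0 for some N
   and M > 0, then W_{M-1} is injective on U(N,M); since it is, up to scalars,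
   its own commutator with D and with L_1, and the commutator of L_2 and
   W_{M-2}, a trace argument leaves only M = a = 1, b = 0.  The same argument
   with L_{N-1} and L_1 brings N down to 2.  A common eigenvector of D, L_1, W_0
   in U(2,M) then generates V freely over C[∂]. *)

Set Implicit Arguments.
Unset Strict Implicit.
Unset Printing Implicit Defensive.

Import GRing.Theory Num.Theory.
Local Open Scope ring_scope.

(** * Finite-dimensional linear algebra over K for predicates on V *)

Section LinearAlgebra.
Variables (K : numClosedFieldType) (V : lmodType {poly K}).
Implicit Types (U : V -> Prop) (T X : V -> V).

Record subspace U : Prop := Subspace {
  sub0 : U 0;
  subD : forall u w, U u -> U w -> U (u + w);
  subZ : forall (c : K) u, U u -> U (c%:P *: u)
}.

Record klinear T : Prop := KLinear {
  klinD : forall u w, T (u + w) = T u + T w;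
  klinZ : forall (c : K) u, T (c%:P *: u) = c%:P *: T u
}.

Definition comb m (e : 'I_m -> V) (c : 'rV[K]_m) : V :=
  \sum_i (c 0 i)%:P *: e i.

(** Bounding the size of independent families, instead of giving a basis, lets smaller predicates
    inherit the property directly. *)
Definition findim U : Prop := exists D, forall m (u : 'I_m -> V),
  (D < m)%N -> (forall i, U (u i)) -> exists2 c, c != 0 & comb u c = 0.

Definition nonzero U : Prop := exists2 u, U u & u <> 0.

Lemma combD m (e : 'I_m -> V) c d : comb e (c + d) = comb e c + comb e d.
Proof.
rewrite /comb -big_split; apply: eq_bigr => i _ /=.
by rewrite mxE polyCD scalerDl.
Qed.

Lemma combZ m (e : 'I_m -> V) a c : comb e (a *: c) = a%:P *: comb e c.
Proof.
rewrite /comb scaler_sumr; apply: eq_bigr => i _ /=.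
by rewrite mxE polyCM scalerA.
Qed.

Lemma combB m (e : 'I_m -> V) c d : comb e (c - d) = comb e c - comb e d.
Proof. by rewrite combD -[- d]scaleN1r combZ polyCN scaleNr scale1r. Qed.

Lemma subspace_comb U m (e : 'I_m -> V) c :
  subspace U -> (forall i, U (e i)) -> U (comb e c).
Proof.
move=> sU eU; rewrite /comb; elim/big_ind: _ => [||i _].
- exact: sub0.
- exact: subD.
- by apply: subZ.
Qed.

Lemma klin0 T : klinear T -> T 0 = 0.
Proof. by move=> kT; apply: (addrI (T 0)); rewrite -(klinD kT) !addr0. Qed.

Lemma klin_comb T m (e : 'I_m -> V) c :
  klinear T -> T (comb e c) = comb (T \o e) c.
Proof.
move=> kT; rewrite /comb (big_morph T (klinD kT) (klin0 kT)).
by apply: eq_bigr => i _; rewrite (klinZ kT).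
Qed.

Lemma klinB T u w : klinear T -> T (u - w) = T u - T w.
Proof.
move=> kT; rewrite (klinD kT); congr (_ + _).
by rewrite -scaleN1r -polyC1 -polyCN (klinZ kT) polyCN scaleNr scale1r.
Qed.

Lemma comb_mulmx m n (e : 'I_n -> V) (f : 'I_m -> V) (A : 'M_(m, n)) c :
  (forall i, f i = comb e (row i A)) -> comb f c = comb e (c *m A).
Proof.
move=> fE; rewrite /comb.
under eq_bigr do rewrite fE /comb scaler_sumr.
rewrite exchange_big /=; apply: eq_bigr => j _.
rewrite mxE rmorph_sum scaler_suml /=; apply: eq_bigr => i _.
by rewrite scalerA polyCM mxE.
Qed.

Lemma tall_dependent m n (A : 'M[K]_(m, n)) :
  (n < m)%N -> exists2 c : 'rV_m, c != 0 & c *m A = 0.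
Proof.
move=> nm; have : kermx A != 0.
  rewrite kermx_eq0 /row_free neq_ltn; apply/orP; left.
  exact: leq_ltn_trans (rank_leq_col A) nm.
by move=> /rowV0Pn[c /sub_kermxP cA c0]; exists c.
Qed.

(** An independent family in [U] of maximal size must span: a vector outside its span could be
    prepended. *)
Lemma findim_basis U : subspace U -> findim U ->
  exists m (e : 'I_m -> V), [/\ forall i, U (e i),
    forall c, comb e c = 0 -> c = 0 & forall u, U u -> exists c, u = comb e c].
Proof.
move=> sU [D fD].
pose P m := boolp.asbool (exists e : 'I_m -> V,
  (forall i, U (e i)) /\ forall c, comb e c = 0 -> c = 0).
have P0 : exists m, P m.
  exists 0%N; apply/boolp.asboolP; exists (fun=> 0); split=> [[]//|c _].
  by apply/rowP => -[].
have PD m : P m -> (m <= D)%N.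
  move=> /boolp.asboolP[e [eU e0]]; rewrite leqNgt; apply/negP => Dm.
  by have [c /eqP c0 /e0] := fD m e Dm eU.
case: (ex_maxnP P0 PD) => m /boolp.asboolP[e [eU e0]] mmax.
exists m, e; split=> // u Uu.
apply: boolp.contrapT => uN; have := mmax m.+1; rewrite ltnn => mN.
suff: P m.+1 by move/mN.
apply/boolp.asboolP.
(* Index 0 carries the new vector [u], and the remaining indices carry [e]. *)
exists (fun i => oapp e u (unlift ord0 i)); split=> [i|c].
  by case: (unlift ord0 i) => [j|] /=; [exact: eU|].
rewrite /comb big_ord_recl unlift_none /=.
under eq_bigr do rewrite liftK /=.
have [c0|c0] := eqVneq (c 0 ord0) 0.
  rewrite c0 scale0r add0r => cE.
  have := e0 (\row_i c 0 (lift ord0 i)); rewrite /comb.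
  under eq_bigr do rewrite mxE.
  move=> /(_ cE)/rowP cE'; apply/rowP => i; rewrite mxE.
  by case: (unliftP ord0 i) => [j ->|->//]; have := cE' j; rewrite !mxE.
move=> /eqP; rewrite addr_eq0 => /eqP uE; case: uN.
exists (- (c 0 ord0)^-1 *: \row_i c 0 (lift ord0 i)).
rewrite combZ /comb; under eq_bigr do rewrite mxE.
rewrite polyCN scaleNr -scalerN -uE scalerA -polyCM mulVf //.
by rewrite scale1r.
Qed.

Lemma op_matrix U m (e : 'I_m -> V) T : klinear T ->
  (forall i, U (e i)) -> (forall u, U u -> exists c, u = comb e c) ->
  (forall u, U u -> U (T u)) ->
  exists A, forall c, T (comb e c) = comb e (c *m A).
Proof.
move=> kT eU eS UT.
have /fin_all_exists[A AE] i : exists c, T (e i) = comb e c by apply/eS/UT.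
exists (\matrix_i A i) => c; rewrite klin_comb //.
by apply: comb_mulmx => i /=; rewrite rowK.
Qed.

Lemma eigenvector U T : subspace U -> findim U -> nonzero U -> klinear T ->
  (forall u, U u -> U (T u)) ->
  exists (c : K) (u : V), [/\ U u, u <> 0 & T u = c%:P *: u].
Proof.
move=> sU fU [u Uu u0] kT UT.
have [m [e [eU e0 eS]]] := findim_basis sU fU.
have [A AE] := op_matrix kT eU eS UT.
have [c uE] := eS _ Uu.
have m0 : (0 < m)%N.
  case: m e eU e0 eS A AE c uE => [|//] e _ _ _ _ _ c uE.
  by case: u0; rewrite uE /comb big_ord0.
have /closed_rootP[x] : size (char_poly A) != 1.
  by rewrite size_char_poly; case: (m) m0.
rewrite -eigenvalue_root_char => /eigenvalueP[v vA v0].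
exists x, (comb e v); split; first exact: subspace_comb.
  by move=> /e0/eqP; apply/negP.
by rewrite AE vA combZ.
Qed.

(* With [C] inverted, [T X - X T = C] becomes a commutator equal to the
   identity matrix, whose trace vanishes. *)
Lemma no_injective_commutator U T X C : subspace U -> findim U -> nonzero U ->
  klinear T -> klinear X -> klinear C ->
  (forall u, U u -> U (T u)) -> (forall u, U u -> U (X u)) ->
  (forall u, U u -> T (X u) - X (T u) = C u) ->
  (forall u, U u -> C (X u) = X (C u)) ->
  (forall u, U u -> C u = 0 -> u = 0) -> False.
Proof.
move=> sU fU [u Uu u0] kT kX kC UT UX TX CX C0.
have UC v : U v -> U (C v).
  move=> Uv.
  have -> : C v = T (X v) + (-1)%:P *: X (T v).
    by rewrite polyCN polyC1 scaleN1r TX.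
  apply: (subD sU); first exact/UT/UX.
  exact/(subZ sU)/UX/UT.
have [m [e [eU e0 eS]]] := findim_basis sU fU.
have [A AE] := op_matrix kT eU eS UT.
have [B BE] := op_matrix kX eU eS UX.
have [F FE] := op_matrix kC eU eS UC.
have Ue c : U (comb e c) by apply: subspace_comb.
have eI c d : comb e c = comb e d -> c = d.
  move=> cd; apply/eqP; rewrite -subr_eq0; apply/eqP/e0.
  by rewrite combB cd subrr.
have mxI (G H : 'M[K]_m) : (forall c : 'rV_m, c *m G = c *m H) -> G = H.
  by move=> GH; apply/row_matrixP => i; rewrite !rowE.
(* Matrices act on row vectors from the right, so [T] after [X] has matrix [B *m A]. *)
have EF : B *m A - A *m B = F.
  apply: mxI => c; apply: eI; rewrite mulmxBr combB !mulmxA -FE -TX //.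
  by rewrite BE AE AE BE.
have FB : B *m F = F *m B.
  by apply: mxI => c; apply: eI; rewrite !mulmxA -!(BE, FE) CX.
have uF : F \in unitmx.
  rewrite -row_free_unit -kermx_eq0; apply/rowV0P => c /sub_kermxP cF.
  by apply/e0/C0 => //; rewrite FE cF /comb big1 // => i _; rewrite mxE scale0r.
(* [B] commutes with the inverse of [F], so by cyclicity the trace of (BA - AB)F^-1 is 0. This trace
   is also m, whence m = 0 in characteristic 0 and [u] = 0. *)
have : \tr (1%:M : 'M[K]_m) = 0.
  have FVB : invmx F *m B = B *m invmx F.
    rewrite -[LHS]mulmx1 -(mulmxV uF) mulmxA -(mulmxA _ B) FB.
    by rewrite !mulmxA mulVmx // mul1mx.
  rewrite -(mulmxV uF) -{1}EF mulmxBl raddfB /= -mulmxA mxtrace_mulC.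
  by rewrite -mulmxA FVB mulmxA subrr.
rewrite mxtrace1 => /eqP; rewrite pnatr_eq0 => /eqP m0.
case: u0; have [c ->] := eS _ Uu.
rewrite /comb; apply: big1 => i _.
by have := ltn_ord i; rewrite [X in (_ < X)%N]m0.
Qed.

End LinearAlgebra.

(** * Coefficients of λ^k (λ + μ)^m and sesquilinearity coefficientwise *)

Section Coefficients.
Variable K : numFieldType.
Local Notation lam := ('X : {poly {poly K}}).
Local Notation del := ('X%:P : {poly {poly K}}).

Lemma coef_lam_mu_binomial k m i j :
  coef_lam_mu K k m i j = (i + j == k + m)%N%:R *+ 'C(m, j).
Proof.
rewrite /coef_lam_mu exprDn mulr_sumr coef_sum coef_sum.
under eq_bigr => t _.
  rewrite mulrnAr mulrA -exprD -polyC_exp !coefMn mul_polyC coefZ coefXn.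
  rewrite mulr_natr coefMn coefXn; over.
rewrite /=.
have [jm|mj] := ltnP j m.+1.
  rewrite (bigD1 (Ordinal jm)) //= eqxx mulr1n big1 ?addr0 => [|t tj].
    by rewrite addnBA // -(eqn_add2r j) subnK // (leq_trans _ (leq_addl _ _)).
  have /negPf -> : j != t :> nat by rewrite eq_sym.
  by rewrite mulr0n mul0rn.
rewrite bin_small // mulr0n big1 // => t _.
have /gtn_eqF -> : (t < j)%N := leq_trans (ltn_ord t) mj.
by rewrite mulr0n mul0rn.
Qed.

Variable V : lmodType {poly K}.

(** Multiplication by λ on coefficient sequences; the value 0 at index 0 plays the role of a
    coefficient of index -1. *)
Definition shift1 (f : nat -> V) n : V := if n is m.+1 then f m else 0.

Lemma lscale_Nlam (f : lpoly V) n : lscale (- lam) f n = - shift1 f n.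
Proof.
rewrite /lscale; case: n => [|n] /=.
  by rewrite big_ord1 coefN coefX oppr0 scale0r oppr0.
rewrite 2!big_ord_recl /= !coefN !coefX /= oppr0 scale0r add0r subn1 /=.
rewrite big1 ?addr0 ?scaleN1r // => i _.
by rewrite coefN coefX oppr0 scale0r.
Qed.

Lemma lscale_del_lam (f : lpoly V) n :
  lscale (del + lam) f n = 'X *: f n + shift1 f n.
Proof.
rewrite /lscale; case: n => [|n] /=.
  by rewrite big_ord1 coefD coefC coefX /= !addr0.
rewrite 2!big_ord_recl /= !coefD !coefC !coefX /= addr0 add0r scale1r.
rewrite subn0 subn1 big1 ?addr0 // => i _.
by rewrite coefD coefC coefX addr0 scale0r.
Qed.

End Coefficients.

(** * The action of r at λ + μ when r has degree at most 1 in λ *)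

Section Bilinear.
Variables (K : numFieldType) (R V : lmodType {poly K}) (A : R -> V -> lpoly V).
Hypothesis cbA : conf_bilinear A.

Lemma act_dell x v n : A ('X *: x) v n = - shift1 (A x v) n.
Proof. by rewrite (cb_dell cbA) lscale_Nlam. Qed.

Lemma act_delr x v n : A x ('X *: v) n = 'X *: A x v n + shift1 (A x v) n.
Proof. by rewrite (cb_delr cbA) lscale_del_lam. Qed.

(** In λ^k (λ + μ)^m the monomial λ^i μ^j occurs only for m = i + j - k, so each of k = 0, 1 leaves
    one term. For i + j = 0 the term k = 1 is absent, which [shift1] provides. *)
Lemma act_lam_muE (r : lpoly R) v i j : (forall k, (1 < k)%N -> r k = 0) ->
  act_lam_mu A r v i j =
    A (r 0%N) v (i + j)%N *+ 'C(i + j, j)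
    + shift1 (A (r 1%N) v) (i + j)%N *+ 'C((i + j).-1, j).
Proof.
move=> r2; rewrite /act_lam_mu (big_finsupp (N := 2)); first last.
- by apply: lsize_le.
- by move=> k ->; rewrite big1 // => m _; rewrite (A0l cbA) scaler0.
have E k : \sum_(m <- finsupp (A (r k) v))
    (coef_lam_mu K k m i j)%:P *: A (r k) v m =
    if (k <= i + j)%N then A (r k) v (i + j - k)%N *+ 'C(i + j - k, j) else 0.
  rewrite (big_finsupp (N := maxn (lsize (A (r k) v)) (i + j).+1)) ?leq_maxl //;
    last by move=> m ->; rewrite scaler0.
  under eq_bigr do rewrite coef_lam_mu_binomial.
  case: leqP => [kij|ijk]; last first.
    rewrite big1 // => m _; rewrite ltn_eqF ?mul0rn ?scale0r //.
    exact: (leq_trans ijk (leq_addr _ _)).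
  have ltN : (i + j - k < maxn (lsize (A (r k) v)) (i + j).+1)%N.
    by rewrite leq_max ltnS leq_subr orbT.
  rewrite (bigD1 (Ordinal ltN)) //= subnKC // eqxx mulr1n.
  rewrite -[_ *+ _]mulr_natr mul1r polyCMn scaler_nat big1 ?addr0 // => m mN.
  case: eqP => [ijE|_]; last by rewrite mul0rn scale0r.
  by case/eqP: mN; apply: val_inj; rewrite /= -(addKn k m) -ijE.
rewrite !big_ord_recl big_ord0 /= !E addr0 leq0n subn0.
by case: (i + j)%N => [|n] /=; rewrite ?mul0rn ?subn1.
Qed.

End Bilinear.

(** * The variable y = ∂ + λ and finite-dimensionality of spaces of bounded degree *)

Section Recentering.
Variables (K : numClosedFieldType) (V : lmodType {poly K}).
Local Notation lam := ('X : {poly {poly K}}).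
Local Notation del := ('X%:P : {poly {poly K}}).

(* The coefficient of y^k in f, where y = ∂ + λ, i.e. in
   \sum_n (y - ∂)^n (f n). *)
Definition recenter (f : lpoly V) k : V :=
  \sum_(n < lsize f) ((lam - del) ^+ n)`_k *: f n.

Lemma recenterE N (f : lpoly V) k : (lsize f <= N)%N ->
  recenter f k = \sum_(n < N) ((lam - del) ^+ n)`_k *: f n.
Proof.
move=> fN; pose F n := ((lam - del) ^+ n)`_k *: f n.
have F0 n : f n = 0 -> F n = 0 by rewrite /F => ->; rewrite scaler0.
by rewrite /recenter -(big_finsupp F0 (leqnn _)) (big_finsupp F0 fN).
Qed.

Lemma recenter_high N (f : lpoly V) :
  (forall n, (N <= n)%N -> f n = 0) -> forall k, (N <= k)%N -> recenter f k = 0.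
Proof.
move=> fN k Nk; rewrite (recenterE _ (lsize_le fN)) big1 // => n _.
rewrite nth_default ?scale0r // size_exp_XsubC.
exact: leq_trans (ltn_ord n) Nk.
Qed.

(** Since (y - ∂)^n is monic in y, the top coefficient of f survives recentering; descending
    induction then removes the coefficients one by one. *)
Lemma recenter_inj (f : lpoly V) :
  (forall k, recenter f k = 0) -> forall n, f n = 0.
Proof.
move=> f0; suff H m : forall n, (m <= n)%N -> f n = 0 by move=> n; apply: (H 0%N).
have [N] := ubnP (lsize f - m); elim: N m => // N IH m.
rewrite ltnS => fmN; have [mf|fm] := ltnP m (lsize f); last first.
  by move=> n mn; apply: lsizeP; apply: leq_trans mn.
have fm n : (m < n)%N -> f n = 0.
  by move: n; apply: IH; apply: leq_trans fmN; rewrite subnS prednK ?subn_gt0.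
move=> n; rewrite leq_eqVlt => /orP[/eqP <-|]; last exact: fm.
have := f0 m; rewrite (recenterE _ (lsize_le fm)) big_ord_recr /=.
rewrite big1 ?add0r => [|i _]; last first.
  by rewrite nth_default ?scale0r // size_exp_XsubC.
have /monicP := monic_exp m (monicXsubC ('X : {poly K})).
by rewrite lead_coefE size_exp_XsubC /= => ->; rewrite scale1r.
Qed.

Variables (R : lmodType {poly K}) (A : R -> V -> lpoly V).
Hypothesis cbA : conf_bilinear A.

Lemma recenter_klinear x k : klinear (fun v => recenter (A x v) k).
Proof.
split=> [u v|c u].
  pose N := maxn (lsize (A x (u + v))) (maxn (lsize (A x u)) (lsize (A x v))).
  rewrite !(@recenterE N) ?leq_max ?leqnn ?orbT // -big_split.
  by apply: eq_bigr => n _; rewrite (cb_addr cbA) scalerDr.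
pose N := maxn (lsize (A x (c%:P *: u))) (lsize (A x u)).
rewrite !(@recenterE N) ?leq_max ?leqnn ?orbT // scaler_sumr.
by apply: eq_bigr => n _; rewrite (cb_scaler cbA) !scalerA mulrC.
Qed.

(** In the variable y the rule for x_λ(∂v) reads y (x_λ v), a pure shift of coefficients in which ∂
    no longer appears. *)
Lemma recenter_del x v k :
  recenter (A x ('X *: v)) k = shift1 (recenter (A x v)) k.
Proof.
pose N := maxn (lsize (A x ('X *: v))) (lsize (A x v)).
have vN : (lsize (A x v) <= N)%N by rewrite leq_maxr.
have -> : shift1 (recenter (A x v)) k =
    \sum_(n < N) ((lam - del) ^+ n * lam)`_k *: A x v n.
  case: k => [|k] /=.
    by rewrite big1 // => n _; rewrite coefMX scale0r.
  by rewrite (recenterE _ vN); apply: eq_bigr => n _; rewrite coefMX.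
rewrite (@recenterE N.+1) ?(leqW (leq_maxl _ _)) //.
under eq_bigr => n _ do rewrite (act_delr cbA) scalerDr.
rewrite big_split /= [X in X + _]big_ord_recr [X in _ + X]big_ord_recl /=.
rewrite (lsizeP vN) !scaler0 addr0 add0r -big_split; apply: eq_bigr => n _ /=.
(* This is (y - ∂)^(n+1) + (y - ∂)^n ∂ = (y - ∂)^n y. *)
rewrite add0n exprSr mulrBr coefB coefMC scalerBl scalerA.
by rewrite addrC subrK.
Qed.

Lemma recenter_scale (S : V -> Prop) N x v (p : {poly K}) : subspace S ->
  (forall k, (k < N)%N -> S (recenter (A x v) k)) ->
  forall k, (k < N)%N -> S (recenter (A x (p *: v)) k).
Proof.
move=> sS Sv; elim/poly_ind: p => [|p c IH] k kN.
  by rewrite scale0r (klin0 (recenter_klinear x k)); apply: sub0.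
have kl := recenter_klinear x k.
rewrite scalerDl [p * _]mulrC -scalerA (klinD kl) (klinZ kl) recenter_del.
apply: (subD sS); last exact/(subZ sS)/Sv.
case: k kN {kl} => [|k] kN /=; first exact: sub0.
exact/IH/ltnW.
Qed.

Lemma subspace_span m (h : 'I_m -> V) :
  subspace (fun u => exists c, u = comb h c).
Proof.
split=> [|_ _ [c ->] [d ->]|a _ [c ->]].
- by exists 0; rewrite /comb big1 // => i _; rewrite mxE scale0r.
- by exists (c + d); rewrite combD.
- by exists (a *: c); rewrite combZ.
Qed.

(* After recentering, the coefficients of p(∂)g are combinations of those of g
   with at most the same index, whatever the degree of p. *)
Lemma findim_bounded (I : finType) (x : I -> R) N : finite_module V ->
  (forall v, (forall i n, A (x i) v n = 0) -> v = 0) ->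
  findim (fun v => forall i n, (N <= n)%N -> A (x i) v n = 0).
Proof.
move=> [s [g gV]] ker0.
pose T := ('I_s * 'I_N * I)%type; pose J := ('I_N * I)%type.
pose h (t : 'I_#|{: T}|) :=
  recenter (A (x (enum_val t).2) (g (enum_val t).1.1)) (enum_val t).1.2.
have hV i k v : (k < N)%N -> exists c, recenter (A (x i) v) k = comb h c.
  move=> kN; have sS := subspace_span h; have [c ->] := gV v.
  have kl := recenter_klinear (x i) k.
  rewrite (big_morph (fun w => recenter (A (x i) w) k) (klinD kl) (klin0 kl)).
  elim/big_ind: _ => [||l _]; [exact: sub0 sS|exact: (subD sS)|].
  apply: (recenter_scale _ sS (N := N)) => // k' k'N.
  exists (\row_t (t == enum_rank ((l, Ordinal k'N), i))%:R).
  rewrite /comb (bigD1 (enum_rank ((l, Ordinal k'N), i))) //= big1.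
    by rewrite mxE eqxx scale1r /h enum_rankK addr0.
  by move=> t /negPf tN; rewrite mxE tN scale0r.
(* Each pair in [J] imposes one condition with #|T| coordinates over [h]; with more vectors than
   equations the linear system has a nonzero solution. *)
exists (#|{: J}| * #|{: T}|)%N => m u mD uN.
have /fin_all_exists[c cE] (j : 'I_m) : exists c : J -> 'rV_#|{: T}|,
    forall q : J, recenter (A (x q.2) (u j)) q.1 = comb h (c q).
  pose P (q : J) c := recenter (A (x q.2) (u j)) q.1 = comb h c.
  apply: (@fin_all_exists _ _ P) => q; exact: hV.
pose M := \matrix_(j < m) mxvec (\matrix_(q < #|{: J}|) c j (enum_val q)).
have [d d0 dM] := tall_dependent M mD.
(* The combination vanishes once all its recentered coefficients do: those of index at least [N] by
   the degree bound, the others by the choice of [d]. *)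
exists d => //; apply: ker0 => i; apply: recenter_inj => k.
have kl := recenter_klinear (x i) k.
have [kN|Nk] := ltnP k N; last first.
  apply: (recenter_high (N := N)) Nk => n Nn.
  have klA : klinear (fun v => A (x i) v n).
    by split=> [v w|a v]; rewrite ?(cb_addr cbA) ?(cb_scaler cbA).
  rewrite (klin_comb _ _ klA) /comb big1 // => j _ /=.
  by rewrite uN // scaler0.
pose q : J := (Ordinal kN, i).
rewrite (klin_comb _ _ kl) (@comb_mulmx _ _ _ _ h _ (\matrix_j c j q)) => [|j].
  suff -> : d *m \matrix_j c j q = 0.
    by rewrite /comb big1 // => t _; rewrite mxE scale0r.
  apply/rowP => t; rewrite !mxE.
  have /rowP/(_ (mxvec_index (enum_rank q) t)) := dM; rewrite !mxE => dE.
  rewrite -[RHS]dE; apply: eq_bigr => j _.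
  by rewrite !mxE mxvecE mxE enum_rankK.
by rewrite rowK /= -cE.
Qed.

End Recentering.

(** * Linear operators and the trace argument for [T, X] = cX *)

Section Operators.
Variables (K : numClosedFieldType) (V : lmodType {poly K}).
Implicit Types (U : V -> Prop) (T X : V -> V).

Lemma klinear_scale T (c : K) : klinear T -> klinear (fun v => c%:P *: T v).
Proof.
move=> kT; split=> [u v|d v]; first by rewrite (klinD kT) scalerDr.
by rewrite (klinZ kT) !scalerA mulrC.
Qed.

Lemma findim_sub U U' : (forall u, U u -> U' u) -> findim U' -> findim U.
Proof.
by move=> UU' [D fD]; exists D => m u Dm uU; apply: fD => // i; exact/UU'.
Qed.

(** For c nonzero, C = cX is injective and commutes with X, which [no_injective_commutator]
    excludes. *)
Lemma injective_commutator_scale U T X (c : K) :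
  subspace U -> findim U -> nonzero U -> klinear T -> klinear X ->
  (forall u, U u -> U (T u)) -> (forall u, U u -> U (X u)) ->
  (forall u, U u -> T (X u) - X (T u) = c%:P *: X u) ->
  (forall u, U u -> X u = 0 -> u = 0) -> c = 0.
Proof.
move=> sU fU nU kT kX UT UX TX X0; apply/eqP; apply: contraT => c0.
case: (no_injective_commutator sU fU nU kT kX (klinear_scale c kX)) => //.
  by move=> u Uu; rewrite (klinZ kX).
move=> u Uu /(congr1 ( *:%R (c^-1)%:P)).
by rewrite scalerA -polyCM mulVf // scale1r scaler0; apply: X0.
Qed.

Lemma eigenspace_subspace U T c : subspace U -> klinear T ->
  subspace (fun u => U u /\ T u = c%:P *: u).
Proof.
move=> sU kT; split=> [|u w [Uu Tu] [Uw Tw]|d u [Uu Tu]].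
- by rewrite (klin0 kT) scaler0; split=> //; apply: sub0.
- by rewrite (klinD kT) Tu Tw scalerDr; split=> //; apply: subD.
- by rewrite (klinZ kT) Tu !scalerA mulrC; split=> //; apply: subZ.
Qed.

Lemma klinear_act (R : lmodType {poly K}) (A : R -> V -> lpoly V) x n :
  conf_bilinear A -> klinear (fun v => A x v n).
Proof. by move=> cbA; split=> [u v|c u]; [exact: cb_addr|exact: cb_scaler]. Qed.

Lemma klinear_act0_del (R : lmodType {poly K}) (A : R -> V -> lpoly V) x :
  conf_bilinear A -> klinear (fun v => A x v 0%N - 'X *: v).
Proof.
move=> cbA; have kA := klinear_act x 0%N cbA; split=> [u v|c u].
  by rewrite (klinD kA) scalerDr opprD addrACA.
by rewrite (klinZ kA) scalerBr !scalerA mulrC.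
Qed.

End Operators.

(** * Commutation relations of the coefficient operators *)

Section WabModule.
Variables (K : numClosedFieldType) (a b : K) (V : confModule (Wab a b)).
Implicit Types v : V.

(* Plain coefficients of λ^n: the n-th products divided by n!. *)
Let l n v : V := cact (Wab_L a b) v n.
Let w n v : V := cact (Wab_W a b) v n.
Let sl v n : V := shift1 (cact (Wab_L a b) v) n.
Let sw v n : V := shift1 (cact (Wab_W a b) v) n.
Let D v : V := l 0%N v - 'X *: v.
Let cbV := cm_bilinear V.

(** At λ + μ the ∂ in ∂ + 2λ acts as -(λ + μ) and yields the binomial at i + j, while 2λ yields the
    one at i + j - 1. Both multiply L_{i+j-1}, read as 0 when i + j = 0. *)
Lemma comm_LL i j v : l i (l j v) - l j (l i v) =
  (2%:R * 'C((i + j).-1, j)%:R - 'C(i + j, j)%:R)%:P *: sl v (i + j)%N.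
Proof.
have cE k : ('X%:P + 2%:R * 'X : {poly {poly K}})`_k =
    (if k == 0%N then 'X else 0) + (k == 1%N)%:R *+ 2.
  by rewrite mulr_natl coefD coefC coefMn coefX.
rewrite /l /sl cm_comm (act_lam_muE cbV) => [|k k1]; last first.
  by rewrite Wab_LL cE; case: k k1 => [|[|k]] // _; rewrite mul0rn addr0 scale0r.
rewrite !Wab_LL !cE /= mul0rn addr0 add0r -polyC1 -polyCMn (act_dell cbV).
case: (i + j)%N => [|n] /=; first by rewrite oppr0 !mul0rn add0r scaler0.
rewrite (cb_scalel cbV) addrC polyCB scalerBl polyCM -scalerA mulNrn.
by rewrite !polyC_natr !scaler_nat -!mulrnA mulnC.
Qed.

(** As for [comm_LL], with a in place of 2; the constant b contributes the term in W_{i+j}. *)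
Lemma comm_LW i j v : l i (w j v) - w j (l i v) =
  (a * 'C((i + j).-1, j)%:R - 'C(i + j, j)%:R)%:P *: sw v (i + j)%N
  + (b * 'C(i + j, j)%:R)%:P *: w (i + j)%N v.
Proof.
rewrite /l /w /sw cm_comm (act_lam_muE cbV) => [|k k1]; last first.
  rewrite Wab_LW !coefD !coefC coefCM coefX.
  by case: k k1 => [|[|k]] // _; rewrite mulr0 !addr0 scale0r.
rewrite !Wab_LW !coefD !coefCM !coefC !coefX /= !(mulr0, mulr1, addr0, add0r).
rewrite scalerDl (cb_addl cbV) (act_dell cbV) !(cb_scalel cbV).
rewrite !polyCM -[in RHS]scalerA polyC_natr scaler_nat -scalerMnr.
case: (i + j)%N => [|n] /=.
  by rewrite oppr0 add0r mul0rn addr0 scaler0 add0r.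
rewrite (cb_scalel cbV) polyCB scalerBl polyCM -!scalerA !polyC_natr.
by rewrite !scaler_nat -!scalerMnr mulrnDl mulNrn addrC addrA.
Qed.

Lemma comm_WW i j v : w i (w j v) = w j (w i v).
Proof.
apply/eqP; rewrite -subr_eq0 /w cm_comm (act_lam_muE cbV) => [|k _]; last first.
  exact: Wab_WW.
rewrite !Wab_WW; case: (i + j)%N => [|n] /=; rewrite !(A0l cbV) !mul0rn.
  by rewrite addr0.
by rewrite addr0.
Qed.

Let kL n : klinear (l n). Proof. exact: klinear_act. Qed.
Let kW n : klinear (w n). Proof. exact: klinear_act. Qed.
Let kD : klinear D. Proof. exact: klinear_act0_del. Qed.

Let subE (p q x s : V) : p - x - (q - (x + s)) = p - q + s.
Proof. by rewrite opprB !addrA subrK addrAC. Qed.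

(** The binomial vanishes for n > 0; for n = 0 it is 1, as the predecessor is truncated, but then
    [shift1] is 0. *)
Let shift1_bin (f : nat -> V) n : 'C(n.-1, n)%:R%:P *: shift1 f n = 0.
Proof. by case: n => [|n]; rewrite ?scaler0 // bin_small // scale0r. Qed.

(** Both L_0 and ∂ have commutator -L_{n-1} with L_n, and these cancel in D. For W_n the same
    cancellation leaves only the term in b. *)
Lemma comm_DL n v : D (l n v) = l n (D v).
Proof.
apply/eqP; rewrite -subr_eq0 /D (klinB _ _ (kL n)).
have -> : l n ('X *: v) = 'X *: l n v + sl v n by exact: act_delr.
rewrite subE comm_LL add0n binn polyCB polyCM scalerBl -scalerA.
by rewrite shift1_bin scaler0 scale1r sub0r addNr.
Qed.

Lemma comm_DW n v : D (w n v) - w n (D v) = b%:P *: w n v.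
Proof.
rewrite /D (klinB _ _ (kW n)).
have -> : w n ('X *: v) = 'X *: w n v + sw v n by exact: act_delr.
rewrite subE comm_LW add0n binn mulr1 polyCB polyCM scalerBl -scalerA.
by rewrite shift1_bin scaler0 scale1r sub0r addrAC addNr add0r.
Qed.

Lemma comm_L1L n v : l 1%N (l n v) - l n (l 1%N v) = (1 - n%:R)%:P *: l n v.
Proof.
by rewrite comm_LL add1n binn binSn /=; congr (_%:P *: _); ring.
Qed.

Lemma comm_L1W n v : l 1%N (w n v) - w n (l 1%N v) =
  (a - n.+1%:R)%:P *: w n v + (b * n.+1%:R)%:P *: w n.+1 v.
Proof. by rewrite comm_LW add1n binn binSn /= mulr1. Qed.

(** * The subspaces U(N,M) and the operators preserving them *)

Definition truncated N M v : Prop :=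
  (forall n, (N <= n)%N -> l n v = 0) /\ (forall n, (M <= n)%N -> w n v = 0).

Lemma truncated_subspace N M : subspace (truncated N M).
Proof.
split=> [|u v [Lu Wu] [Lv Wv]|c u [Lu Wu]]; split=> n nN.
- exact: klin0.
- exact: klin0.
- by rewrite (klinD (kL n)) Lu ?Lv ?addr0.
- by rewrite (klinD (kW n)) Wu ?Wv ?addr0.
- by rewrite (klinZ (kL n)) Lu ?scaler0.
- by rewrite (klinZ (kW n)) Wu ?scaler0.
Qed.

Lemma truncated_D N M v : truncated N M v -> truncated N M (D v).
Proof.
move=> [Lv Wv]; split=> n nN.
  by rewrite -comm_DL Lv // (klin0 kD).
have := comm_DW n v; rewrite Wv // (klin0 kD) scaler0 sub0r.
by move/eqP; rewrite oppr_eq0 => /eqP.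
Qed.

(** The commutators of L_m with L_n and W_n involve only indices n + m - 1 and n + m, which are at
    least n because m > 0. *)
Lemma truncated_L N M m v : (0 < m)%N -> truncated N M v ->
  truncated N M (l m v).
Proof.
case: m => // m _ [Lv Wv]; split=> n nN.
  have := comm_LL n m.+1 v; rewrite (Lv n) // (klin0 (kL _)) subr0 => ->.
  by rewrite /sl addnS /= -/(l _ v) Lv ?scaler0 // (leq_trans nN) ?leq_addr.
have := comm_LW m.+1 n v; rewrite (Wv n) // (klin0 (kL _)) sub0r => /eqP.
have Mmn : (M <= m + n)%N := leq_trans nN (leq_addl _ _).
rewrite eqr_oppLR /sw addSn /= -!/(w _ v) !Wv ?(leqW Mmn) //.
by rewrite !scaler0 addr0 oppr0 => /eqP.
Qed.

(** For n >= N > M the commutator of L_n and W_m involves W_{n+m-1} and W_{n+m}, whose indices are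
    at least M. *)
Lemma truncated_W N M m v : (M < N)%N -> truncated N M v ->
  truncated N M (w m v).
Proof.
move=> MN [Lv Wv]; split=> n nN; last first.
  by rewrite comm_WW (Wv n) // (klin0 (kW _)).
have := comm_LW n m v; rewrite (Lv n) // (klin0 (kW _)) subr0 => ->.
have Mn : (M <= n + m)%N.
  by rewrite (leq_trans (ltnW MN)) // (leq_trans nN) ?leq_addr.
rewrite (Wv (n + m)%N) // scaler0 addr0 /sw.
case: n nN Mn => [|n] nN Mn; first by move: (leq_trans MN nN).
rewrite addSn /= -/(w _ v) Wv ?scaler0 //.
by rewrite -ltnS (leq_trans MN) // (leq_trans nN) // -addSn leq_addr.
Qed.

(** * Lowering the bounds M and N, and a common eigenvector *)

Hypothesis finV : finite_module V.
Hypothesis ker0 : forall v,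
  (forall n, l n v = 0) -> (forall n, w n v = 0) -> v = 0.

(** As M <= N, both families vanish from index N on, so one bound serves for L and W, indexed by
    [bool]. *)
Lemma truncated_findim N M : (M <= N)%N -> findim (truncated N M).
Proof.
move=> MN; pose x (i : bool) := if i then Wab_L a b else Wab_W a b.
have := @findim_bounded K V (Wab a b) (@cact _ _ V) cbV bool x N finV.
move=> fd; apply: findim_sub (fd _) => [v [Lv Wv] [] n Nn|v v0].
- exact: Lv.
- by apply: Wv; apply: leq_trans Nn.
- by apply: ker0 => n; [exact: (v0 true)|exact: (v0 false)].
Qed.

Lemma W_truncation : (exists v : V, v <> 0) -> exists M,
  (M = 0%N \/ [/\ M = 1%N, a = 1 & b = 0]) /\
  exists2 N, (M < N)%N & nonzero (truncated N M).
Proof.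
move=> [v0 v0N].
(* Minimality is imposed on M alone; a suitable N is then read off the finite support of L_λ u. *)
pose P M := boolp.asbool
  (exists2 u : V, (forall n, (M <= n)%N -> w n u = 0) & u <> 0).
have P0 : exists M, P M.
  exists (lsize (cact (Wab_W a b) v0)); apply/boolp.asboolP; exists v0 => // n.
  exact: lsizeP.
case: (ex_minnP P0) => M /boolp.asboolP[u Wu u0] Mmin.
have nT : exists2 N, (M < N)%N & nonzero (truncated N M).
  exists (maxn M.+1 (lsize (cact (Wab_L a b) u))); first exact: leq_maxl.
  by exists u => //; split=> // n; rewrite geq_max => /andP[_ /lsizeP].
exists M; split=> //; case: M => [|M] in Mmin nT u Wu u0 *; first by left.
right; have [N MN nTN] := nT.
have fT := truncated_findim (ltnW MN); have sT := truncated_subspace N M.+1.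
(* A nonzero vector of U(N,M+1) killed by W_M as well would contradict minimality. *)
have W_inj v : truncated N M.+1 v -> w M v = 0 -> v = 0.
  move=> [_ Wv] WM; apply: boolp.contrapT => vN.
  suff /Mmin : P M by rewrite ltnn.
  apply/boolp.asboolP; exists v => // n.
  by rewrite leq_eqVlt => /orP[/eqP <-//|]; apply: Wv.
have TW m v : truncated N M.+1 v -> truncated N M.+1 (w m v).
  exact: truncated_W.
have TL m v : truncated N M.+1 v -> truncated N M.+1 (l m.+1 v).
  exact: truncated_L.
have b0 : b = 0.
  apply: (injective_commutator_scale sT fT nTN kD (kW M)) => //.
  - by move=> v; apply: truncated_D.
  - exact: TW.
  - by move=> v _; rewrite comm_DW.
have bE x : b * x = 0 by rewrite b0 mul0r.
have aM : a = M.+1%:R.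
  apply/eqP; rewrite -subr_eq0; apply/eqP.
  apply: (injective_commutator_scale sT fT nTN (kL 1) (kW M)) => //.
  - exact: TL.
  - exact: TW.
  - by move=> v _; rewrite comm_L1W bE scale0r addr0.
case: M => [|M] in Mmin nT u Wu u0 aM N MN nTN fT sT W_inj TW TL *.
  by split.
(* Now a = M + 2, so a(M + 1) = 2 C(M+2, 2). Hence the commutator of L_2 and W_M is W_{M+1} times 2C
   - C = C with C = C(M+2, M), which is nonzero. *)
have binE : a * M.+1%:R = ('C(M.+2, M) * 2)%:R.
  have <- : 'C(M.+2, 2) = 'C(M.+2, M).
    by rewrite -(@bin_sub M.+2 M) ?leqW // subSn // subSnn.
  by rewrite aM -natrM -[2%N in RHS]/(2`!) bin_ffact ffactnS ffactn1.
have c0 : 'C(M.+2, M)%:R != 0 :> K by rewrite pnatr_eq0 -lt0n bin_gt0 leqW.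
have comm v : l 2 (w M v) - w M (l 2 v) = 'C(M.+2, M)%:R%:P *: w M.+1 v.
  rewrite comm_LW bE scale0r addr0 add2n /= binSn binE natrM mulr_natr.
  by rewrite mulr2n addrK.
case: (no_injective_commutator sT fT nTN (kL 2) (kW M) 
  (klinear_scale 'C(M.+2, M)%:R (kW M.+1))).
- exact: TL.
- exact: TW.
- by move=> v _; apply: comm.
- by move=> v _; rewrite comm_WW -(klinZ (kW M)).
move=> v Tv /(congr1 ( *:%R ('C(M.+2, M)%:R^-1)%:P)).
by rewrite scalerA -polyCM mulVf // scale1r scaler0; apply: W_inj.
Qed.

(** Where U(N+1,M) is nonzero but U(N,M) is zero, L_N is injective on U(N+1,M). Its commutator with
    L_1 is (1 - N)L_N, which forces N = 1, so the descent can stall only at or below the bound 2. *)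
Lemma L_truncation M N : (M < 2)%N -> (M < N)%N -> nonzero (truncated N M) ->
  nonzero (truncated 2 M).
Proof.
move=> M2; elim: N => [|N IH]; rewrite ?ltn0 // ltnS => MN nT.
have [N1|N2] := leqP N 1.
  case: nT => u [Lu Wu] u0; exists u => //; split=> // n n2.
  exact/Lu/(leq_trans _ n2).
have [nT'|nT'] := boolp.pselect (nonzero (truncated N M)).
  by apply: IH => //; apply: leq_trans N2.
have L_inj v : truncated N.+1 M v -> l N v = 0 -> v = 0.
  move=> [Lv Wv] LN; apply: boolp.contrapT => vN; apply: nT'.
  exists v => //; split=> // n.
  by rewrite leq_eqVlt => /orP[/eqP <-//|]; apply: Lv.
have MN1 : (M < N.+1)%N by rewrite ltnS.
have /eqP : 1 - N%:R = 0 :> K.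
  apply: (injective_commutator_scale (truncated_subspace N.+1 M)
    (truncated_findim (ltnW MN1)) nT (kL 1) (kL N)) => //.
  - by move=> v; apply: truncated_L.
  - by move=> v; apply: truncated_L; apply: ltnW.
  - by move=> v _; apply: comm_L1L.
by rewrite subr_eq0 eq_sym pnatr_eq1 gtn_eqF.
Qed.

(** D, L_1 and W_0 commute on U(2,M), so each successive eigenspace is stable under the next
    operator, giving the eigenvalues β, α, γ in turn. *)
Lemma singular_vector : (exists v : V, v <> 0) ->
  exists (v : V) (al be ga : K), [/\ v <> 0, (ga = 0 \/ a = 1 /\ b = 0),
    forall n, l n v =
      ('X%:P + al%:P%:P * 'X + be%:P%:P : {poly {poly K}})`_n *: v
    & forall n, w n v = (ga%:P%:P : {poly {poly K}})`_n *: v].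
Proof.
move=> /W_truncation[M [Mab [N MN nT]]].
have M2 : (M < 2)%N by case: Mab => [->|[->]].
have {MN nT}nT := L_truncation M2 MN nT.
have sT := truncated_subspace 2 M; have fT := truncated_findim (ltnW M2).
pose U0 := truncated 2 M.
have [be [u1 [T1 u1N D1]]] := eigenvector sT fT nT kD (@truncated_D 2 M).
pose U1 v := U0 v /\ D v = be%:P *: v.
have sU1 : subspace U1 by exact: eigenspace_subspace.
have fU1 : findim U1 by apply: findim_sub fT => v [].
have L1 v : U1 v -> U1 (l 1%N v).
  move=> [Tv Dv]; split; first exact: truncated_L.
  by rewrite comm_DL Dv (klinZ (kL 1)).
have nU1 : nonzero U1 by exists u1.
have [al [u2 [U12 u2N L2]]] := eigenvector sU1 fU1 nU1 (kL 1) L1.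
pose U2 v := U1 v /\ l 1%N v = al%:P *: v.
(* Either M = 0 and W_0 is zero on U(2,M), or b = 0 and the commutator vanishes. *)
have W_D v : U0 v -> D (w 0%N v) = w 0%N (D v).
  move=> [_ Wv]; have /eqP := comm_DW 0 v.
  case: Mab => [M0|[_ _ b0]]; last first.
    by rewrite {1}[in b%:P]b0 scale0r subr_eq0 => /eqP.
  by rewrite Wv ?M0 // scaler0 subr_eq0 => /eqP.
have W_L v : U0 v -> l 1%N (w 0%N v) = w 0%N (l 1%N v).
  move=> [_ Wv]; have /eqP := comm_L1W 0 v.
  rewrite (Wv 1%N) // scaler0 addr0.
  case: Mab => [M0|[_ a1 _]]; last first.
    have -> : a - 1 = 0 by rewrite a1 subrr.
    by rewrite scale0r subr_eq0 => /eqP.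
  by rewrite Wv ?M0 // scaler0 subr_eq0 => /eqP.
have sU2 : subspace U2 by exact: eigenspace_subspace.
have fU2 : findim U2 by apply: findim_sub fU1 => v [].
have W0 v : U2 v -> U2 (w 0%N v).
  move=> [[Tv Dv] Lv]; split; first split.
  - exact: truncated_W.
  - by rewrite W_D // Dv (klinZ (kW 0)).
  - by rewrite W_L // Lv (klinZ (kW 0)).
have nU2 : nonzero U2 by exists u2.
have [ga [v [[[[Lv Wv] Dv] L1v] vN W0v]]] := eigenvector sU2 fU2 nU2 (kW 0) W0.
exists v, al, be, ga; split=> //.
(* If M = 0 then W_0 v = 0, so the eigenvalue γ is 0. *)
- case: Mab => [M0|[]]; [left | by right].
  apply/eqP; apply: contraT => ga0; case: vN.
  move: W0v; rewrite Wv ?M0 // => /(congr1 ( *:%R (ga^-1)%:P)).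
  by rewrite scaler0 scalerA -polyCM mulVf // scale1r.
(* The coefficient at λ^0 is L_0 v = ∂v + Dv = (∂ + β)v; from λ^2 on, truncation gives 0. *)
- case=> [|[|n]]; rewrite !coefD !coefC coefCM coefX /=.
  + by rewrite mulr0 addr0 scalerDl -Dv /D addrC subrK.
  + by rewrite mulr1 add0r addr0.
  + by rewrite Lv // mulr0 !addr0 scale0r.
- case=> [|n]; rewrite coefC //=.
  by rewrite Wv ?scale0r //; case: Mab => [->|[->]].
Qed.

End WabModule.

(** * From generators to the whole module by sesquilinearity; torsion *)

Section Extension.
Variables (K : numClosedFieldType) (R V : lmodType {poly K}).
Variable A : R -> V -> lpoly V.
Hypothesis cbA : conf_bilinear A.

Section Closed.
Variable S : V -> Prop.
Hypotheses (S0 : S 0) (SD : forall u w, S u -> S w -> S (u + w)).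
Hypothesis SZ : forall (p : {poly K}) u, S u -> S (p *: u).

Let shift1_closed (f : nat -> V) n : (forall k, S (f k)) -> S (shift1 f n).
Proof. by case: n => [|n] Sf /=. Qed.

(** By sesquilinearity, ∂ in an argument only shifts coefficients or multiplies them by ∂, and a
    submodule absorbs both; induction on p follows. *)
Lemma act_scalel_closed x v (p : {poly K}) : (forall n, S (A x v n)) ->
  forall n, S (A (p *: x) v n).
Proof.
move=> Sx; elim/poly_ind: p => [|p c IH] n.
  by rewrite scale0r (A0l cbA).
rewrite scalerDl [p * _]mulrC -scalerA (cb_addl cbA) (cb_scalel cbA).
rewrite (act_dell cbA) -scaleN1r.
by apply: SD; apply: SZ => //; apply: shift1_closed.
Qed.

Lemma act_scaler_closed x v (p : {poly K}) : (forall n, S (A x v n)) ->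
  forall n, S (A x (p *: v) n).
Proof.
move=> Sx; elim/poly_ind: p => [|p c IH] n.
  by rewrite scale0r (A0r cbA).
rewrite scalerDl [p * _]mulrC -scalerA (cb_addr cbA) (cb_scaler cbA).
rewrite (act_delr cbA); apply: SD; last exact: SZ.
by apply: SD; [apply: SZ | apply: shift1_closed].
Qed.

End Closed.

Section Morphism.
Variables (M : lmodType {poly K}) (B : R -> M -> lpoly M) (f : {linear V -> M}).
Hypothesis cbB : conf_bilinear B.

Let shift1_morph (g : nat -> V) (h : nat -> M) n :
  (forall k, f (g k) = h k) -> f (shift1 g n) = shift1 h n.
Proof. by case: n => [|n] gh /=; rewrite ?linear0 ?gh. Qed.

(** This and the next lemma reduce compatibility of f with the actions to generators of the algebra
    and of the module. *)
Lemma act_scalel_morph x v (p : {poly K}) :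
  (forall n, f (A x v n) = B x (f v) n) ->
  forall n, f (A (p *: x) v n) = B (p *: x) (f v) n.
Proof.
move=> fx; elim/poly_ind: p => [|p c IH] n.
  by rewrite !scale0r (A0l cbA) (A0l cbB) linear0.
rewrite scalerDl [p * _]mulrC -scalerA (cb_addl cbA) (cb_scalel cbA).
rewrite (cb_addl cbB) (cb_scalel cbB) (act_dell cbA) (act_dell cbB).
by rewrite linearD linearN linearZ /= fx (shift1_morph _ IH).
Qed.

Lemma act_scaler_morph x v (p : {poly K}) :
  (forall n, f (A x v n) = B x (f v) n) ->
  forall n, f (A x (p *: v) n) = B x (f (p *: v)) n.
Proof.
move=> fx; elim/poly_ind: p => [|p c IH] n.
  by rewrite !scale0r (A0r cbA) linear0 (A0r cbB).
rewrite scalerDl [p * _]mulrC -scalerA (cb_addr cbA) (cb_scaler cbA).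
rewrite (act_delr cbA) linearD [f (_ + shift1 _ _)]linearD.
rewrite [f (_ *: A _ _ _)]linearZ [f (c%:P *: _)]linearZ /= fx IH.
rewrite (shift1_morph _ IH) [f ('X *: _ + _)]linearD.
rewrite [f ('X *: _)]linearZ [f (c%:P *: v)]linearZ /=.
by rewrite (cb_addr cbB) (cb_scaler cbB) (act_delr cbB).
Qed.

End Morphism.

(* If (∂ - c)u = 0, comparing coefficients of λ^(n+1) in
   x_λ(∂u) = (∂ + λ)(x_λ u) gives x_n u = (c - ∂)(x_(n+1) u), so that x_λ u
   vanishes by descending induction on n. *)
Lemma torsion_kernel (c : K) (u : V) :
  'X *: u = c%:P *: u -> forall x n, A x u n = 0.
Proof.
move=> uc x; suff H N n : (lsize (A x u) - n <= N)%N -> A x u n = 0.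
  by move=> n; apply: (H _ _ (leqnn _)).
elim: N n => [|N IH] n; first by rewrite leqn0 subn_eq0; apply: lsizeP.
move=> nN; have An : A x u n.+1 = 0.
  by apply: IH; rewrite subnS -subn1 leq_subLR add1n.
have := act_delr cbA x u n.+1.
by rewrite uc (cb_scaler cbA) An !scaler0 add0r.
Qed.

(** p splits into linear factors over K. By [torsion_kernel] a vector killed by ∂ - z lies in the
    kernel of the action, hence is 0, so the factors can be stripped one at a time. *)
Lemma torsion_free : (forall u, (forall x n, A x u n = 0) -> u = 0) ->
  forall (p : {poly K}) (u : V), p != 0 -> p *: u = 0 -> u = 0.
Proof.
move=> ker0 p u p0; have [r pE] := closed_field_poly_normal p.
rewrite pE -mul_polyC.
move/(congr1 ( *:%R ((lead_coef p)^-1)%:P)).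
rewrite scalerA mulrA -polyCM mulVf ?lead_coef_eq0 // mul1r scaler0 {p p0 pE}.
elim: r u => [|z r IH] u; first by rewrite big_nil scale1r.
rewrite big_cons mulrC -scalerA => /IH /eqP.
rewrite scalerBl subr_eq0 => /eqP /torsion_kernel; exact: ker0.
Qed.

End Extension.

(** * Structure of irreducible modules *)

Section Classification.
Variables (K : numClosedFieldType) (a b : K).

(** The isomorphism sends p(∂)v to p(∂)e; it respects the actions because it does so for L and W on
    v. *)
Lemma rank_one_iso (V M : confModule (Wab a b)) (v : V) (e : M)
    (q r : {poly {poly K}}) :
  bijective (fun p : {poly K} => p *: v) ->
  bijective (fun p : {poly K} => p *: e) ->
  (forall n, cact (Wab_L a b) v n = q`_n *: v) ->
  (forall n, cact (Wab_W a b) v n = r`_n *: v) ->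
  (forall n, cact (Wab_L a b) e n = q`_n *: e) ->
  (forall n, cact (Wab_W a b) e n = r`_n *: e) ->
  module_iso V M.
Proof.
move=> [g gK Kg] [h hK Kh] Lv Wv Le We.
pose f u : M := g u *: e.
have f_linear : linear f.
  move=> p u w; rewrite /f scalerA -scalerDl; congr (_ *: _).
  by apply: (can_inj gK); rewrite Kg scalerDl -scalerA !Kg.
pose F : {linear V -> M} := HB.pack f (GRing.isLinear.Build _ _ _ _ f f_linear).
have fv p : F (p *: v) = p *: e by rewrite /= /f gK.
have fv1 : F v = e by rewrite -[v]scale1r fv scale1r.
exists F; split.
  exists (fun m => h m *: v) => [u|m]; last by rewrite fv Kh.
  by rewrite /= /f hK Kg.
have cV := cm_bilinear V; have cM := cm_bilinear M.
move=> x u n; rewrite (Wab_basis x) (cb_addl cV) (cb_addl cM) linearD -(Kg u).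
congr (_ + _); apply: act_scalel_morph => // {}n;
  apply: act_scaler_morph => // {}n.
- by rewrite Lv fv fv1 Le.
- by rewrite Wv fv fv1 We.
Qed.

Variable V : confModule (Wab a b).

Lemma act_generators_kernel (v : V) :
  (forall n, cact (Wab_L a b) v n = 0) -> (forall n, cact (Wab_W a b) v n = 0) ->
  forall x n, cact x v n = 0.
Proof.
move=> Lv Wv x n; have cV := cm_bilinear V.
pose S (u : V) := u = 0.
have SD u w : S u -> S w -> S (u + w) by move=> -> ->; apply: addr0.
have SZ (p : {poly K}) u : S u -> S (p *: u) by move=> ->; apply: scaler0.
rewrite (Wab_basis x) (cb_addl cV).
by apply: (SD); apply: (act_scalel_closed cV (S := S)).
Qed.

(** The vectors killed by the whole action form a submodule, which cannot be all of V when V is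
    nontrivial. *)
Lemma irreducible_kernel : ~ trivial_module V -> irreducible_module V ->
  forall v : V, (forall x n, cact x v n = 0) -> v = 0.
Proof.
move=> nt [_ irr]; have cV := cm_bilinear V.
have [|//|kerV] := irr (fun v => forall x n, cact x v n = 0); last first.
  by case: nt => x v; apply: kerV.
split=> [x n|u w Ku Kw x n|p u Ku x n|x u n Ku y m].
- exact: (A0r cV).
- by rewrite (cb_addr cV) Ku Kw addr0.
- apply: (act_scaler_closed cV (S := fun u => u = 0)) => // {Ku u x n p}.
  + by move=> u w -> ->; apply: addr0.
  + by move=> p u ->; apply: scaler0.
- by rewrite Ku (A0r cV).
Qed.

(** Used with q = 1 to show that v generates V, and with q = ∂ + β to exclude α = γ = 0. *)
Lemma cyclic_submodule (v : V) (q : {poly K}) :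
  (forall n, exists p, cact (Wab_L a b) v n = p *: (q *: v)) ->
  (forall n, exists p, cact (Wab_W a b) v n = p *: (q *: v)) ->
  conf_submodule (fun u : V => exists p : {poly K}, u = p *: (q *: v)).
Proof.
pose S (u : V) := exists p : {poly K}, u = p *: (q *: v).
have S0 : S 0 by exists 0; rewrite scale0r.
have SD u w : S u -> S w -> S (u + w).
  by move=> [c ->] [d ->]; exists (c + d); rewrite scalerDl.
have SZ (p : {poly K}) u : S u -> S (p *: u).
  by move=> [c ->]; exists (p * c); rewrite scalerA.
move=> Lv Wv; split=> // x u n [p ->]; have cV := cm_bilinear V.
rewrite -/(S _) scalerA (Wab_basis x) (cb_addl cV).
by apply: (SD); apply: (act_scalel_closed cV S0 SD SZ) => // {}n;
  apply: (act_scaler_closed cV S0 SD SZ).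
Qed.

Lemma classification : finite_module V -> ~ trivial_module V ->
  irreducible_module V ->
  exists (v : V) (al be ga : K),
    [/\ bijective (fun p : {poly K} => p *: v),
        (ga = 0 \/ a = 1 /\ b = 0) /\ (al <> 0 \/ ga <> 0),
        forall n, cact (Wab_L a b) v n =
          ('X%:P + al%:P%:P * 'X + be%:P%:P : {poly {poly K}})`_n *: v
      & forall n, cact (Wab_W a b) v n = (ga%:P%:P : {poly {poly K}})`_n *: v].
Proof.
move=> fV ntV irrV; have ker0 := irreducible_kernel ntV irrV.
have cV := cm_bilinear V; have tf := torsion_free cV ker0.
have [nzV irr] := irrV.
have [|v [al [be [ga [v0 gaE Lv Wv]]]]] := singular_vector fV _ nzV.
  by move=> v Lv Wv; apply/ker0/act_generators_kernel.
have v_gen u : exists p : {poly K}, u = p *: v.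
  have [|V0|Vv] := irr (fun u => exists p : {poly K}, u = p *: (1 *: v)).
  - by apply: cyclic_submodule => n; rewrite scale1r ?Lv ?Wv; eexists.
  - by case: v0; apply: V0; exists 1; rewrite !scale1r.
  - by have [p ->] := Vv u; exists p; rewrite scale1r.
(* Freeness is torsion-freeness applied to the nonzero vector v. *)
have v_inj : injective (fun p : {poly K} => p *: v).
  move=> p q /= /eqP; rewrite -subr_eq0 -scalerBl => /eqP pq.
  by apply/eqP; rewrite -subr_eq0; apply: contraT => /tf/(_ pq).
exists v, al, be, ga; split=> //.
- have gP u : exists p : {poly K}, u == p *: v.
    by have [p /eqP] := v_gen u; exists p.
  have gK u : xchoose (gP u) *: v = u by rewrite -(eqP (xchooseP (gP u))).
  by exists (fun u => xchoose (gP u)) => [p|//]; apply: v_inj; apply: gK.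
split=> //; have [al0|/eqP al0] := eqVneq al 0; last by left.
(* If α = γ = 0 then L_λ v = (∂ + β)v and W_λ v = 0, so (∂ + β)v spans a submodule, which turns out
   to be nonzero and proper. *)
right=> ga0; pose q : {poly K} := 'X + be%:P.
have [|V0|Vv] := irr (fun u => exists p : {poly K}, u = p *: (q *: v)).
- apply: cyclic_submodule => n; rewrite ?Lv ?Wv ?al0 ?ga0; last first.
    by exists 0; rewrite polyC0 coef0 !scale0r.
  exists (n == 0%N)%:R; rewrite mul0r addr0 -polyCD coefC.
  by case: n => [|n] /=; rewrite ?scale1r // !scale0r.
- have q0 : q != 0 by rewrite -size_poly_eq0 size_XaddC.
  by case: v0; apply: (tf _ _ q0); apply: V0; exists 1; rewrite scale1r.
have [p] := Vv v; rewrite scalerA -{1}[v]scale1r => /v_inj.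
(* From 1 = p (∂ + β), evaluation at ∂ = -β gives 1 = 0. *)
move/(congr1 (fun r => r.[- be])); rewrite hornerM !hornerE addNr mulr0.
by move/eqP; rewrite oner_eq0.
Qed.

End Classification.

(** * Comparison with the explicit rank one modules *)

Lemma polyo_free (K : fieldType) :
  bijective (fun p : {poly K} => p *: (1 : {poly K}^o)).
Proof. by exists id => p; rewrite /GRing.scale /= mulr1. Qed.

Lemma Wab_classification (K : numClosedFieldType) (a b : K) :
  (a <> 1 \/ b <> 0 ->
     forall V : confModule (Wab a b),
       finite_module V -> ~ trivial_module V -> irreducible_module V ->
       free_rank_one V /\
       exists alpha beta : K,
         alpha <> 0 /\ module_iso V (M_ab a b alpha beta)) /\
  (forall V : confModule (Wab (1 : K) 0),
     finite_module V -> ~ trivial_module V -> irreducible_module V ->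
     free_rank_one V /\
     exists alpha beta gamma : K,
       (alpha <> 0 \/ gamma <> 0) /\ module_iso V (M_10 alpha beta gamma)).
Proof.
split=> [ab|] V fV ntV irrV;
  have [v [al [be [ga [vbij [ga0 alga] Lv Wv]]]]] := classification fV ntV irrV;
  split; try by exists v.
- have {}ga0 : ga = 0 by case: ga0 ab => // -[-> ->] [].
  exists al, be; split; first by case: alga => // /(_ ga0).
  apply: (rank_one_iso (M := M_ab a b al be) vbij (@polyo_free K) Lv Wv).
    exact: M_ab_L.
  by move=> n; rewrite M_ab_W ga0 polyC0 coef0 scale0r.
exists al, be, ga; split=> //.
apply: (rank_one_iso (M := M_10 al be ga) vbij (@polyo_free K) Lv Wv).
  exact: M_10_L.
exact: M_10_W.
Qed.

Local Open Scope complex_scope.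

Theorem theorem3p10 (R : realType) (a b : R[i]) :
  (a <> 1 \/ b <> 0 ->
     forall V : confModule (Wab a b),
       finite_module V -> ~ trivial_module V -> irreducible_module V ->
       free_rank_one V /\
       exists alpha beta : R[i],
         alpha <> 0 /\ module_iso V (M_ab a b alpha beta)) /\
  (forall V : confModule (Wab (1 : R[i]) 0),
     finite_module V -> ~ trivial_module V -> irreducible_module V ->
     free_rank_one V /\
     exists alpha beta gamma : R[i],
       (alpha <> 0 \/ gamma <> 0) /\ module_iso V (M_10 alpha beta gamma)).
Proof. exact: Wab_classification. Qed.
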